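(* Consider, for $N\in\mathbb{N}$, the stationary Dirichlet problem $$u_{xx}+f(x,u,\omega)+F=0 \ \text{ in } [-N+\delta,N-\delta],\qquad u(-N+\delta)=u(N-\delta)=0,$$ with the random field $f$ and driving field $F>0$ described in the context. There exist constants $F_0>0$, $C>0$ and $K>0$ such that for every $F>F_0$ and every sufficiently large $N$ the following holds: if $u(\cdot,\omega)$ is a nonnegative solution of this problem (depending measurably on $\omega$), then $$\mathbb{P}\Big(\big\{\omega:\ u(x,\omega)\ge \big(K(N-1)-K|x|\big)_+ \text{ for all } x\in[-N+\delta,N-\delta]\big\}\Big)\ge 1-Ce^{-N/C},$$ where $a_+=\max\{a,0\}$.
   Context: Fix $\delta$ with $0<\delta\ll 1/2$ and $\lambda_0>0$. Let $\mathbb{Z}^*=\mathbb{Z}+\tfrac12$ and $b_{i,j}=(i,j)$ for $(i,j)\in\mathbb{Z}\times\mathbb{Z}^*$. Let $\phi\in C_c^\infty(\mathbb{R}^2)$ be nonnegative with support in $[-\delta,\delta]^2$, and put $\phi_{i,j}(x,s)=\phi((x,s)-b_{i,j})$. Let $(l(i,j))_{(i,j)\in\mathbb{Z}\times\mathbb{Z}^*}$ be i.i.d. exponential random variables on a probability space $(\Omega,\mathcal{F},\mathbb{P})$ with $\mathbb{P}(l(i,j)>r)=e^{-\lambda_0 r}$ for $r\ge0$. The random field is $f(x,s,\omega)=g(x,s)-\sum_{(i,j)\in\mathbb{Z}\times\mathbb{Z}^*} l(i,j)(\omega)\phi_{i,j}(x,s)$, where $g$ is a nonnegative $C^1$ function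 on $\mathbb{R}^2$ such that $\lim_{L\to\infty}(2L)^{-2}\int_{[-L,L]^2}f(x,s)\,dx\,ds=0$. $F>0$ is a constant. *)

(* Defs.v *)
From HB Require Import structures.
From mathcomp Require Import all_boot all_order all_algebra.
From mathcomp Require Import all_classical all_reals all_analysis.
Set Implicit Arguments. Unset Strict Implicit. Unset Printing Implicit Defensive.
Import Order.TTheory GRing.Theory Num.Theory.
Import numFieldNormedType.Exports.
Local Open Scope classical_set_scope.
Local Open Scope ring_scope.

Section Defs.
Variable R : realType.

Definition pderiv (b : bool) (h : R -> R -> R) : R -> R -> R :=
  if b then fun x s => derive1 (fun y => h y s) x
  else fun x s => derive1 (fun t => h x t) s.

Definition pderivable (b : bool) (h : R -> R -> R) : Prop :=
  forall x s, if b then derivable (fun y => h y s) x 1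
              else derivable (fun t => h x t) s 1.

Fixpoint iter_pderiv (bs : seq bool) (h : R -> R -> R) : R -> R -> R :=
  match bs with
  | [::] => h
  | b :: bs' => pderiv b (iter_pderiv bs' h)
  end.

Definition Ck2 (k : nat) (h : R -> R -> R) : Prop :=
  forall bs : seq bool, (size bs <= k)%N ->
    continuous (fun z : R * R => iter_pderiv bs h z.1 z.2) /\
    ((size bs < k)%N -> forall b, pderivable b (iter_pderiv bs h)).

Definition Cinf2 (h : R -> R -> R) : Prop := forall k, Ck2 k h.

(* lattice point b_{i,j} = (i, j) with (i,j) in Z x Z^*, Z^* = Z + 1/2;
   the index k = (i, m) : int * int encodes (i, m + 1/2) *)
Definition bpt (k : int * int) : R * R := (k.1%:~R, k.2%:~R + 2^-1).

(* the random field f(x,s,w) = g(x,s) - sum_{(i,j)} l(i,j)(w) phi((x,s) - b_{i,j});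
   the (locally finite) sum is the finitely-supported sum of fsbigop *)
Definition rfield (T : Type) (g phi : R -> R -> R) (l : int * int -> T -> R)
    (x s : R) (w : T) : R :=
  g x s - \sum_(k \in [set: int * int]) l k w * phi (x - (bpt k).1) (s - (bpt k).2).

Definition mutually_independent (d : measure_display) (T : measurableType d)
    (P : probability T R) (I : eqType) (X : I -> T -> R) : Prop :=
  forall (J : seq I) (B : I -> set R), uniq J -> (forall i, measurable (B i)) ->
    P (\bigcap_(i in [set i | i \in J]) (X i @^-1` B i)) =
    (\prod_(i <- J) P (X i @^-1` B i))%E.

Definition dirichlet_solution (h : R -> R -> R) (F a b : R) (u : R -> R) : Prop :=
  {within `[a, b], continuous u} /\
  (forall x, a < x < b ->
     derivable u x 1 /\ derivable (derive1 u) x 1 /\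
     derive1 (derive1 u) x + h x (u x) + F = 0) /\
  u a = 0 /\ u b = 0.

End Defs.

(* Main.v *)
Require Import Defs.
From HB Require Import structures.
From mathcomp Require Import all_boot all_order all_algebra.
From mathcomp Require Import all_classical all_reals all_analysis.
From mathcomp Require Import measurable_realfun zify ring lra.
Set Implicit Arguments. Unset Strict Implicit. Unset Printing Implicit Defensive.
Import Order.TTheory GRing.Theory Num.Theory.
Import numFieldNormedType.Exports.
Local Open Scope classical_set_scope.
Local Open Scope ring_scope.

(** Let [D n] and [Ga n] be the integrals over the unit cell around column [n] of
    the positive part [H] (the obstacles) and of the rest [G >= F] of
    [u'' = H - G].  Testing the equation against the tent function with peak at a
    point [x0] where [u x0 < N - 1 - |x0|] gives
    [sum w_n Ga n <= 2 + sum D n], with weights [w_n] comparable to the distance to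
    the boundary divided by [N]; as [Ga n >= F], the obstacles met by [u] must
    have total strength of order [F N].

    A union bound over discretised paths shows that this is exponentially
    unlikely.  Record the integer parts of height and slope at each cell boundary
    and an integer bound [V n] of [D n + Ga n]; given the state in a cell there are
    [O((1 + V)^2)] possible next states.  By Jensen's inequality
    [exp (th D n)] is at most the average, with respect to occupation times, of
    the exponentials of the obstacle strengths.  A path entering with slope [s]
    spends time [O((1 + V) / (1 + |s|))] at each of the [O(1 + |s| + V)]
    heights it can reach, so each cell costs a factor [O((1 + V)^2)] in mean, even
    for steep paths that meet many obstacles.  Summing against the price
    [exp (- th w_n V n)] costs [O(w_n^-5)] per cell, and the product of the
    [w_n^-1] is exponential in [N] by Stirling.  All these constants are
    independent of [F], while [V n >= F] yields a gain [exp (- c F N)]. *)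

(** * Union over discretised paths *)

Section cylinder_domination.
Context {R : realType} {d : measure_display} {T : measurableType d}.
Variables (P : probability T R) (l : int * int -> T -> R) (lam : R).
Hypothesis l_meas : forall k, measurable_fun setT (l k).
Hypothesis l_indep : mutually_independent P l.
Hypothesis l_tail : forall k (r : R), 0 <= r ->
  P [set w | r < l k w] = (expR (- (lam * r)))%:E.

Definition cylinder (J : seq (int * int)) (B : int * int -> set R) : set T :=
  \bigcap_(i in [set i | i \in J]) (l i @^-1` B i).

Lemma measurable_cylinder J B : (forall i, measurable (B i)) ->
  measurable (cylinder J B).
Proof.
move=> mB; rewrite /cylinder; apply: fin_bigcap_measurable.
  exact: finite_seq.
by move=> i _; rewrite -[_ @^-1` _]setTI; exact: l_meas.
Qed.

Lemma measurable_exceed k (r : R) : measurable [set w | r < l k w].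
Proof.
rewrite (_ : [set _ | _] = setT `&` l k @^-1` `]r, +oo[); first exact: l_meas.
by rewrite setTI; apply/seteqP; split => w /=; rewrite in_itv/= andbT.
Qed.

(** A constraint on a fresh index turns a cylinder into a cylinder, so independence factors the tail
    probability out and the class of conditioning events stays closed under the recursion over
    columns. *)
Lemma cylinder_exceed J B k (r : R) : uniq J -> (forall i, measurable (B i)) ->
  k \notin J -> 0 <= r -> exists B', [/\ forall i, measurable (B' i),
    cylinder J B `&` [set w | r < l k w] = cylinder (k :: J) B' &
    P (cylinder (k :: J) B') = ((expR (- (lam * r)))%:E * P (cylinder J B))%E].
Proof.
move=> uJ mB kJ r0; pose B' i := if i == k then `]r, +oo[%classic else B i.
have mB' i : measurable (B' i) by rewrite /B'; case: ifP.
exists B'; split => //.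
- apply/seteqP; split => [w [wJ wk] i /=|w wJ].
    rewrite inE /B'; case: eqVneq => [->|ik] /=; first by rewrite in_itv/= wk.
    exact: wJ.
  split => [i iJ|].
    have := wJ i; rewrite /= inE iJ orbT => /(_ isT); rewrite /B'.
    by case: eqVneq => // ik; move: iJ; rewrite /= ik (negPf kJ).
  by have := wJ k; rewrite /= inE eqxx => /(_ isT); rewrite /B' eqxx /= in_itv/= andbT.
- rewrite /cylinder !l_indep//; last by rewrite /= kJ.
  rewrite big_cons; congr (_ * _)%E.
    rewrite -(l_tail k) //; congr (P _); apply/seteqP.
    by split=> w /=; rewrite /B' eqxx /= in_itv/= andbT.
  rewrite big_seq [RHS]big_seq; apply: eq_bigr => i iJ; rewrite /B'.
  by case: eqVneq => // ik; move: iJ; rewrite ik (negPf kJ).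
Qed.

(* [dominated c X a]: conditionally on any event depending on finitely many
   columns to the left of column [c], the mean of [X] is at most [a]. *)
Definition dominated (c : int) (X : T -> R) (a : R) : Prop :=
  [/\ measurable_fun setT X, forall w, 0 <= X w, 0 <= a &
    forall J B, uniq J -> (forall i, measurable (B i)) ->
      (forall i, i \in J -> i.1 < c) ->
      (\int[P]_(w in cylinder J B) (X w)%:E <= a%:E * P (cylinder J B))%E].

Lemma dominated_le c X a b : a <= b -> dominated c X a -> dominated c X b.
Proof.
move=> ab [mX X0 a0 H]; split => // [|J B uJ mB Jc]; first exact: le_trans ab.
by apply: (le_trans (H J B uJ mB Jc)); apply: lee_wpmul2r.
Qed.

Lemma dominated_weaken c c' X a : c <= c' -> dominated c' X a -> dominated c X a.
Proof.
move=> cc' [mX X0 a0 H]; split => // J B uJ mB Jc; apply: H => // i /Jc ic.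
exact: lt_le_trans cc'.
Qed.

Lemma dominated1 c : dominated c (fun=> 1) 1.
Proof.
split => // J B uJ mB Jc; have mC := measurable_cylinder J mB.
by rewrite integral_cst.
Qed.

Lemma dominated_sum c (I : Type) (s : seq I) (X : I -> T -> R) (a : I -> R) :
  (forall i, dominated c (X i) (a i)) ->
  dominated c (fun w => \sum_(i <- s) X i w) (\sum_(i <- s) a i).
Proof.
move=> H; split.
- by apply: measurable_sum => i; case: (H i).
- by move=> w; apply: sumr_ge0 => i _; case: (H i).
- by apply: sumr_ge0 => i _; case: (H i).
move=> J B uJ mB Jc; have mC := measurable_cylinder J mB.
under eq_integral do rewrite -sumEFin.
rewrite ge0_integral_sum//; last 2 first.
- move=> i; apply/measurable_EFinP/measurable_funTS; by case: (H i).
- by move=> i w _; rewrite lee_fin; case: (H i).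
rewrite -sumEFin ge0_sume_distrl; last by move=> i _; rewrite lee_fin; case: (H i).
by apply: lee_sum => i _; case: (H i) => _ _ _; exact.
Qed.

Lemma dominatedZ c X a (z : R) : 0 <= z ->
  dominated c X a -> dominated c (fun w => z * X w) (z * a).
Proof.
move=> z0 [mX X0 a0 H]; split.
- exact: measurable_funM.
- by move=> w; rewrite mulr_ge0.
- by rewrite mulr_ge0.
move=> J B uJ mB Jc; have mC := measurable_cylinder J mB.
under eq_integral do rewrite EFinM.
rewrite ge0_integralZl//; last 2 first.
- exact/measurable_EFinP/measurable_funTS.
- by move=> w _; rewrite lee_fin.
by rewrite EFinM -muleA; apply: lee_wpmul2l; [rewrite lee_fin|exact: H].
Qed.

Lemma dominatedD c X Y a b : dominated c X a -> dominated c Y b ->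
  dominated c (fun w => X w + Y w) (a + b).
Proof.
move=> HX HY.
have := @dominated_sum c bool [:: true; false]
  (fun b => if b then X else Y) (fun i => if i then a else b).
rewrite !big_cons big_nil addr0 => H.
have {H} : dominated c
    (fun w => \sum_(i <- [:: true; false]) (if i then X else Y) w) (a + b).
  by apply: H; case.
by congr dominated; apply/funext => w; rewrite !big_cons big_nil addr0.
Qed.

(** The indicator is absorbed into the conditioning cylinder, which then lies to the left of column
    [c + 1], where the bound on [X] applies. This plays the part of a conditional expectation given
    the earlier columns. *)
Lemma dominated_exceed (c : int) (k : int * int) X a (r : R) : 0 <= r -> k.1 = c ->
  dominated (c + 1) X a ->
  dominated c (fun w => ((r < l k w)%R)%:R * X w) (expR (- (lam * r)) * a).
Proof.
move=> r0 kc [mX X0 a0 H].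
have E w : ((r < l k w)%R)%:R = \1_[set w | r < l k w] w :> R.
  by rewrite indicE mem_setE.
split.
- under eq_fun do rewrite E.
  by apply: measurable_funM => //; apply: measurable_indic; exact: measurable_exceed.
- by move=> w; rewrite mulr_ge0.
- by rewrite mulr_ge0 ?expR_ge0.
move=> J B uJ mB Jc; have mC := measurable_cylinder J mB.
rewrite (_ : integral _ _ _ =
    (\int[P]_(w in cylinder J B `&` [set w | (r < l k w)%R]) (X w)%:E)%E); last first.
  rewrite integral_mkcondr; apply: eq_integral => w _.
  by rewrite epatch_indic mulrC E EFinM.
have kJ : k \notin J by apply/negP => /Jc; rewrite kc ltxx.
have [B' [mB' -> PE]] := cylinder_exceed uJ mB kJ r0.
rewrite EFinM [((expR _)%:E * _)%E]muleC -muleA -PE; apply: H => //=; first by rewrite kJ.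
move=> i; rewrite inE => /predU1P[->|/Jc ic].
  by rewrite kc ltrDl.
by rewrite (lt_trans ic)// ltrDl.
Qed.

(** A layer-cake majorant of [expR (lam / 2 * Num.max x 0)] for [x] up to [M]. Being a finite
    combination of the indicators of [m < x], it can be handled by [dominated_exceed]; the factor
    [expR (lam / 2)] pays for rounding [x] down. *)
Definition layers (M : nat) (x : R) : R :=
  expR (lam / 2) *
  (1 + \sum_(m < M) expR (lam / 2 * m%:R) * ((m%:R < x)%R)%:R).

(** The exponent [lam / 2] is half the rate of the tail, so layer [m] contributes
    [expR (- (lam / 2 * m))] in mean and the series is bounded uniformly in [M]. *)
Lemma dominated_layers (c1 : R) M (c : int) (k : int * int) X a : 0 <= lam ->
  expR (lam / 2) * (1 + \sum_(m < M) expR (- (lam / 2 * m%:R))) <= c1 ->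
  k.1 = c -> dominated (c + 1) X a ->
  dominated c (fun w => layers M (l k w) * X w) (c1 * a).
Proof.
move=> lam0 c1M kc dX; have a0 : 0 <= a by case: dX.
have dX' : dominated c X a by apply: dominated_weaken dX; rewrite lerDl.
apply: (@dominated_le _ _
    (expR (lam / 2) * (a + \sum_(m < M) expR (lam / 2 * m%:R) *
                            (expR (- (lam * m%:R)) * a)))).
  rewrite (_ : _ * _ = expR (lam / 2) *
      (1 + \sum_(m < M) expR (- (lam / 2 * m%:R))) * a); first exact: ler_wpM2r.
  rewrite -mulrA mulrDl mul1r mulr_suml; congr (_ * (_ + _)).
  by apply: eq_bigr => m _; rewrite mulrA -expRD; congr (expR _ * _); lra.
rewrite (_ : (fun w => _) = fun w => expR (lam / 2) * (X w + \sum_(m < M)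
    expR (lam / 2 * m%:R) * (((m%:R < l k w)%R)%:R * X w))); last first.
  apply/funext => w; rewrite /layers -mulrA mulrDl mul1r mulr_suml.
  by congr (_ * (_ + _)); apply: eq_bigr => m _; rewrite mulrA.
apply: dominatedZ; first exact: expR_ge0.
apply: dominatedD => //; apply: dominated_sum => m.
by apply: dominatedZ; [exact: expR_ge0|exact: dominated_exceed].
Qed.

(* Sum over all discretised paths of [k] cells, starting in cell [n] at height
   [h] with slope [s]: [V] bounds the total variation of the slope in the cell,
   [p] and [q] encode the rounded changes of height and slope. *)
Fixpoint path_sum (M : nat) (rt : nat -> R) (col : nat -> int) (k n : nat)
    (h s : int) (w : T) : R :=
  if k is k'.+1 then
    \sum_(V < M) \sum_(p < 2 * V + 5) \sum_(q < 2 * V + 5)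
      (expR (- (rt n * V%:R)) * (8 * (1 + V%:R) / (1 + `|s|%N%:R))) *
      \sum_(t < 2 * `|s|%N + 2 * V + 5)
         layers M (l (col n, h - (`|s|%N + V + 2)%N%:Z + t%:Z) w) *
         path_sum M rt col k' n.+1 (h + s + (p%:Z - (V + 2)%N%:Z))
           (s + (q%:Z - (V + 2)%N%:Z)) w
  else 1.

(** Each [layers] factor concerns column [col n] and the rest of the path only later columns, so the
    cells are peeled off one by one. The number of heights is at most [5 (1 + V) (1 + |s|)] and
    cancels the occupation factor [1 / (1 + |s|)], which makes the bound uniform in the slope;
    [1000] is [8 * 5 * 25]. *)
Lemma dominated_path_sum (M : nat) (rt A : nat -> R) (col : nat -> int) (c1 : R) :
  0 <= lam -> 
  expR (lam / 2) * (1 + \sum_(m < M) expR (- (lam / 2 * m%:R))) <= c1 ->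
  (forall n, col n.+1 = col n + 1) ->
  (forall n, 1000 * c1 * \sum_(V < M) (1 + V%:R) ^+ 4 * expR (- (rt n * V%:R)) <= A n) ->
  forall k n h s, dominated (col n) (path_sum M rt col k n h s)
                    (\prod_(j < k) A (n + j)%N).
Proof.
move=> lam0 c1M colS HA; elim=> [|k IH] n h s.
  by rewrite big_ord0 /=; exact: dominated1.
have c10 : 0 <= c1.
  apply: le_trans c1M; apply: mulr_ge0 (expR_ge0 _) (addr_ge0 ler01 _).
  by apply: sumr_ge0 => i _; exact: expR_ge0.
rewrite big_ord_recl /= addn0; set B := \prod_(i < k) _.
have B0 : 0 <= B.
  have [_ _ + _] := IH n.+1 0 0; congr (_ <= _); rewrite /B.
  by apply: eq_bigr => i _; rewrite /bump /= addSnnS.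
have dP h' s' : dominated (col n + 1) (path_sum M rt col k n.+1 h' s') B.
  rewrite -colS; have := IH n.+1 h' s'; congr dominated.
  by apply: eq_bigr => i _; rewrite /bump /= addSnnS.
apply: (@dominated_le _ _ (\sum_(V < M) \sum_(p < 2 * V + 5) \sum_(q < 2 * V + 5)
      (expR (- (rt n * V%:R)) * (8 * (1 + V%:R) / (1 + `|s|%N%:R))) *
      \sum_(t < 2 * `|s|%N + 2 * V + 5) c1 * B)); last first.
  apply: dominated_sum => V; apply: dominated_sum => p; apply: dominated_sum => q.
  apply: dominatedZ.
    by rewrite mulr_ge0 ?expR_ge0// divr_ge0// ?mulr_ge0// addr_ge0.
  by apply: dominated_sum => t; exact: dominated_layers.
apply: le_trans (ler_wpM2r B0 (HA n)).
rewrite mulr_sumr mulr_suml; apply: ler_sum => V _.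
have sum_cst n' (x : R) : \sum_(i < n') x = x * n'%:R.
  by rewrite sumr_const card_ord mulr_natr.
rewrite !sum_cst.
have s0 : 0 < 1 + `|s|%N%:R :> R by apply: ltr_pwDl.
have V0 : 0 <= V%:R :> R by [].
have S0 : 0 <= `|s|%N%:R :> R by [].
rewrite (natrD _ (2 * V)%N 5) (natrD _ _ 5) (natrD _ (2 * _)%N) !(natrM _ 2).
move: (expR_ge0 (- (rt n * V%:R))).
set e := expR _; move: V0 S0 s0; set v := V%:R; set S := `|s|%N%:R => v0 S0 s0 e0.
have H1 : (2 * S + 2 * v + 5) / (1 + S) <= 5 * (1 + v).
  by rewrite ler_pdivrMr//; nra.
have -> : e * (8 * (1 + v) / (1 + S)) * (c1 * B * (2 * S + 2 * v + 5)) *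
    (2 * v + 5) * (2 * v + 5) =
    (e * c1 * B) * ((8 * (1 + v) * (2 * v + 5) ^+ 2) * ((2 * S + 2 * v + 5) / (1 + S))).
  by field; rewrite gt_eqF.
have -> : 1000 * c1 * ((1 + v) ^+ 4 * e) * B = (e * c1 * B) * (1000 * (1 + v) ^+ 4).
  by ring.
apply: ler_wpM2l; first by rewrite !mulr_ge0.
apply: (@le_trans _ _ ((8 * (1 + v) * (2 * v + 5) ^+ 2) * (5 * (1 + v)))).
  by apply: ler_wpM2l => //; rewrite mulr_ge0 ?sqr_ge0// mulr_ge0// addr_ge0.
have H2 : (2 * v + 5) ^+ 2 <= 25 * (1 + v) ^+ 2 by nra.
have -> : 8 * (1 + v) * (2 * v + 5) ^+ 2 * (5 * (1 + v)) =
  (40 * (1 + v) ^+ 2) * (2 * v + 5) ^+ 2 by ring.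
have -> : 1000 * (1 + v) ^+ 4 = (40 * (1 + v) ^+ 2) * (25 * (1 + v) ^+ 2) by ring.
by apply: ler_wpM2l => //; rewrite mulr_ge0// sqr_ge0.
Qed.

End cylinder_domination.

(** * Elementary estimates *)

Section elementary_bounds.
Context {R : realType}.
Implicit Types (x e : R).

Lemma exprn_le_fact_expR x n : 0 <= x -> x ^+ n <= n`!%:R * expR x.
Proof.
move=> x0; case: n => [|n].
  by rewrite expr0 fact0 mul1r; apply: le_trans (expR_ge1Dx x); rewrite lerDl.
rewrite mulrC -ler_pdivrMr ?ltr0n ?fact_gt0//.
by apply: le_trans (expR_ge1Dxn n x0); rewrite lerDr.
Qed.

Lemma sum_expRN_le e M : 0 < e ->
  \sum_(v < M) expR (- (e * v%:R)) <= 1 + e^-1.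
Proof.
move=> e0; set q := expR (- e).
have E (v : 'I_M) : expR (- (e * v%:R)) = q ^+ v.
  by rewrite /q -expRM_natl; congr expR; rewrite mulrN mulrC.
under eq_bigr do rewrite E.
have q1 : q * (1 + e) <= 1.
  rewrite /q expRN mulrC ler_pdivrMr ?expR_gt0// mul1r.
  exact: expR_ge1Dx.
have q0 : 0 <= q by exact: expR_ge0.
have S0 : 0 <= \sum_(v < M) q ^+ v by apply: sumr_ge0 => i _; rewrite exprn_ge0.
have : (1 - q) * \sum_(v < M) q ^+ v <= 1.
  by have := subrX1 q M; move: (exprn_ge0 M q0); lra.
move: S0; set S := \sum_(_ < _) _ => S0 qS.
rewrite -(ler_pM2l e0) mulrDr mulr1 divff ?gt_eqF//.
nra.
Qed.

(** Half of the exponent absorbs the polynomial at the cost [24 (2 / e)^4], and the other half is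
    summed as a geometric series bounded by [3 / e]; [1152] is [24 * 16 * 3]. *)
Lemma sum_poly_expRN_le e M : 0 < e <= 1 ->
  \sum_(v < M) (1 + v%:R) ^+ 4 * expR (- (e * v%:R)) <= 1152 * expR 1 / e ^+ 5.
Proof.
move=> /andP[e0 e1].
have e20 : 0 < e / 2 by rewrite divr_gt0.
apply: (@le_trans _ _ (\sum_(v < M)
    (24 * (2 / e) ^+ 4 * expR 1) * expR (- (e / 2 * v%:R)))).
  apply: ler_sum => v _.
  have v1 : 0 <= 1 + v%:R :> R by rewrite addr_ge0.
  have /(@exprn_le_fact_expR _ 4) : 0 <= e / 2 * (1 + v%:R).
    by rewrite mulr_ge0// ltW.
  rewrite exprMn (_ : 4`!%:R = 24 :> R)// => H.
  have H2 : (1 + v%:R) ^+ 4 <= 24 * (2 / e) ^+ 4 * expR (e / 2 * (1 + v%:R)).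
    rewrite -(ler_pM2l (exprn_gt0 4 e20)); apply: (le_trans H).
    rewrite le_eqVlt; apply/orP; left; apply/eqP; field.
    by rewrite gt_eqF.
  apply: (le_trans (ler_wpM2r (expR_ge0 _) H2)).
  rewrite -[leLHS]mulrA -[leRHS]mulrA; apply: ler_wpM2l.
    by rewrite mulr_ge0// exprn_ge0// divr_ge0// ltW.
  rewrite -!expRD ler_expR; lra.
rewrite -mulr_sumr.
apply: (le_trans (ler_wpM2l _ (sum_expRN_le M e20))).
  by rewrite mulr_ge0 ?expR_ge0// mulr_ge0// exprn_ge0// divr_ge0// ltW.
rewrite (_ : 1152 * expR 1 / e ^+ 5 = 24 * (2 / e) ^+ 4 * expR 1 * (3 / e)); last first.
  by field; rewrite gt_eqF.
apply: ler_wpM2l.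
  by rewrite mulr_ge0 ?expR_ge0// mulr_ge0// exprn_ge0// divr_ge0// ltW.
rewrite ler_pdivlMr// mulrDl mul1r invf_div -mulrA mulVf ?gt_eqF//; lra.
Qed.

Lemma layers_ge (lam : R) M x : 0 <= lam -> Num.max x 0 <= M%:R ->
  expR (lam / 2 * Num.max x 0) <= layers lam M x.
Proof.
move=> lam0 xM; rewrite /layers.
have S0 : 0 <= \sum_(m < M) expR (lam / 2 * m%:R) * ((m%:R < x)%R)%:R.
  by apply: sumr_ge0 => i _; rewrite mulr_ge0// expR_ge0.
have [x0|x0] := leP x 0.
  rewrite mulr0 expR0 mulr_ege1// ?lerDl//.
  by apply: le_trans (expR_ge1Dx _); rewrite lerDl divr_ge0.
move: xM; rewrite (max_l (ltW x0)) => xM.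
have [m mx xm] : exists2 m : nat, m%:R < x & x <= m.+1%:R.
  have ex : exists m, x <= m%:R by exists M.
  case: (ex_minnP ex) => -[|m] xm mmin; first by move: x0; rewrite ltNge xm.
  by exists m => //; rewrite ltNge; apply/negP => /mmin; rewrite ltnn.
have mM : (m < M)%N by rewrite -(ltr_nat R) (lt_le_trans mx).
rewrite (bigD1 (Ordinal mM)) //= mx mulr1.
have -> : expR (lam / 2 * x) = expR (lam / 2) * expR (lam / 2 * (x - 1)).
  by rewrite -expRD; congr expR; lra.
apply: ler_wpM2l; first exact: expR_ge0.
apply: (@le_trans _ _ (expR (lam / 2 * m%:R))).
  rewrite ler_expR; apply: ler_wpM2l; first by rewrite divr_ge0.
  by rewrite lerBlDr natr1.
rewrite addrCA lerDl addr_ge0//.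
by apply: sumr_ge0 => i _; rewrite mulr_ge0// expR_ge0.
Qed.

Lemma prod_succ_fact L : \prod_(n < L) n.+1%:R = L`!%:R :> R.
Proof.
elim: L => [|L IH]; first by rewrite big_ord0 fact0.
by rewrite big_ord_recr IH factS natrM mulrC.
Qed.

(** The product of the relative distances of cell [n] to both ends. It lies below every tent
    function with peak inside the interval, so a single weight serves all positions of the low
    point. *)
Definition weight (kappa : R) (N n : nat) : R :=
  kappa * (n.+1%:R * ((2 * N).-1 - n)%N%:R) / (2 * N%:R) ^+ 2.

Lemma weight_gt0 (kappa : R) N n : 0 < kappa -> (n < (2 * N).-1)%N ->
  0 < weight kappa N n.
Proof.
move=> k0 nL; have N0 : (0 < N)%N by case: N nL.
rewrite /weight divr_gt0// ?exprn_gt0 ?mulr_gt0 ?ltr0n//; lia.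
Qed.

(** With [L = 2N - 1] the product equals [kappa^L (L! / (2N)^L)^2], the second family of distances
    being the first in reverse order. The weak Stirling bound [(2N)^L <= L! e^(2N)] concludes. *)
Lemma prod_weight_ge (kappa : R) N : 0 < kappa -> (0 < N)%N ->
  kappa ^+ (2 * N).-1 * expR (- (4 * N%:R)) <=
  \prod_(n < (2 * N).-1) weight kappa N n.
Proof.
move=> k0 N0; set L := (2 * N).-1.
have -> : \prod_(n < L) weight kappa N n =
    kappa ^+ L * (L`!%:R ^+ 2 / ((2 * N%:R) ^+ L) ^+ 2).
  rewrite /weight -/L prodf_div big_split /= big_split /= prodr_const card_ord.
  rewrite prod_succ_fact [X in _ * (_ * X)](reindex_inj rev_ord_inj) /=.
  rewrite (_ : \prod_(j < L) _ = L`!%:R); last first.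
    rewrite -prod_succ_fact; apply: eq_bigr => j _; congr (_%:R).
    by have := ltn_ord j; lia.
  by rewrite prodr_const card_ord exprAC [in RHS]mulrA [L`!%:R ^+ 2]expr2.
apply: ler_wpM2l; first by rewrite exprn_ge0// ltW.
rewrite -expr_div_n (_ : expR _ = expR (- (2 * N%:R)) ^+ 2); last first.
  by rewrite -expRM_natl; congr expR; lra.
rewrite ler_sqr ?nnegrE ?expR_ge0 ?divr_ge0 ?exprn_ge0 ?mulr_ge0//.
rewrite ler_pdivlMr ?exprn_gt0 ?mulr_gt0 ?ltr0n// expRN mulrC.
by rewrite ler_pdivrMr ?expR_gt0//; apply: exprn_le_fact_expR; rewrite mulr_ge0.
Qed.

Lemma weight_le1 (kappa : R) N n : 0 <= kappa <= 1 -> (0 < N)%N -> 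
  (n < (2 * N).-1)%N -> weight kappa N n <= 1.
Proof.
move=> /andP[k0 k1] N0 nL; rewrite /weight.
rewrite ler_pdivrMr ?exprn_gt0 ?mulr_gt0 ?ltr0n// mul1r.
apply: le_trans (ler_piMl _ k1) _; first by rewrite mulr_ge0.
have -> : 2 * N%:R = (2 * N)%N%:R :> R by rewrite natrM.
rewrite expr2; apply: ler_pM => //; rewrite ler_nat; lia.
Qed.

Lemma weight_ge (kappa : R) N n : 0 <= kappa -> (0 < N)%N ->
  (n < (2 * N).-1)%N -> kappa / (4 * N%:R) <= weight kappa N n.
Proof.
move=> k0 N0 nL; rewrite /weight -mulrA; apply: ler_wpM2l => //.
have n0 : 0 < N%:R :> R by rewrite ltr0n.
rewrite ler_pdivlMr ?exprn_gt0 ?mulr_gt0//.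
have -> : (4 * N%:R)^-1 * (2 * N%:R) ^+ 2 = N%:R :> R by field; rewrite gt_eqF.
rewrite -natrM ler_nat.
nia.
Qed.

Lemma sum_weight_ge (kappa : R) N : 0 <= kappa -> (0 < N)%N ->
  kappa * N%:R / 4 <= \sum_(n < (2 * N).-1) weight kappa N n.
Proof.
move=> k0 N0.
have n1 : 1 <= N%:R :> R by rewrite ler1n.
have S L : \sum_(n < L) (n.+1%:R * (L - n)%N%:R) =
    L%:R * (L%:R + 1) * (L%:R + 2) / 6 :> R.
  have S1 m : \sum_(n < m) n.+1%:R = m%:R * (m%:R + 1) / 2 :> R.
    elim: m => [|m IH]; first by rewrite big_ord0 !mul0r.
    by rewrite big_ord_recr IH /= -natr1; field.
  elim: L => [|L IH]; first by rewrite big_ord0 !mul0r.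
  rewrite (_ : \sum_(n < L.+1) _ = \sum_(n < L) (n.+1%:R * (L - n)%N%:R) + \sum_(n < L.+1) n.+1%:R).
    by rewrite IH S1 -natr1; field.
  rewrite !big_ord_recr /= addrA -big_split /= subSnn mulr1; congr (_ + _).
  apply: eq_bigr => i _; rewrite subSn; last by rewrite ltnW.
  by rewrite -[(L - i).+1%:R]natr1 mulrDr mulr1.
under eq_bigr do rewrite /weight.
rewrite -mulr_suml -mulr_sumr S.
have -> : (2 * N).-1%:R = 2 * N%:R - 1 :> R.
  by rewrite -natrM -[X in _ - X](mulr1n 1) -natrB ?subn1//; lia.
rewrite ler_pdivlMr ?exprn_gt0 ?mulr_gt0 ?ltr0n//.
rewrite -[X in X <= _]mulrA -[X in X <= _]mulrA; apply: ler_wpM2l => //.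
nra.
Qed.

End elementary_bounds.

(** * Primitives and occupation times *)

Section real_analysis.
Context {R : realType}.
Local Notation mu := (@lebesgue_measure R).
Implicit Types (f df : R -> R) (x y z : R).

Lemma is_derive_MVT f df y z : y <= z ->
  (forall x, y <= x <= z -> is_derive x 1 f (df x)) ->
  exists2 x, y <= x <= z & f z - f y = df x * (z - y).
Proof.
move=> yz fdf.
have [| |x xyz E] := @MVT_segment R f df y z yz.
- by move=> x; rewrite in_itv/= => /andP[yx xz]; apply: fdf; rewrite !ltW.
- apply: derivable_within_continuous => x; rewrite in_itv/= => xyz.
  by case: (fdf _ xyz).
by exists x => //; move: xyz; rewrite in_itv.
Qed.

Lemma is_derive_ge0_le f df y z : y <= z ->
  (forall x, y <= x <= z -> is_derive x 1 f (df x)) ->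
  (forall x, y <= x <= z -> 0 <= df x) -> f y <= f z.
Proof.
move=> yz fdf df0; have [x xyz E] := is_derive_MVT yz fdf.
by rewrite -subr_ge0 E mulr_ge0 ?df0// subr_ge0.
Qed.

Lemma continuous_antiderivative f y : continuous f ->
  exists pf : R -> R, forall x, y < x -> is_derive x 1 pf (f x).
Proof.
move=> cf; exists (fun x => \int[mu]_(t in `[y, x]) f t)%R => x yx.
have [| |d E] := @continuous_FTC1_closed R f y x (x + 1) _ _ yx (cf x).
- by rewrite ltrDl.
- apply: continuous_compact_integrable; first exact: segment_compact.
  exact: continuous_subspaceT.
by apply: DeriveDef; [exact: d|rewrite -derive1E; exact: E].
Qed.

(** The tangent line of the exponential at the mean [D] lies below it; integrating this over the
    unit interval amounts to the monotonicity of a difference of primitives. *)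
Lemma jensen_expR f pf ep (th y : R) :
  (forall x, y <= x <= y + 1 -> is_derive x 1 pf (f x)) ->
  (forall x, y <= x <= y + 1 -> is_derive x 1 ep (expR (th * f x))) ->
  expR (th * (pf (y + 1) - pf y)) <= ep (y + 1) - ep y.
Proof.
move=> dpf dep; set D := th * _.
have H : ep y - expR D * ((1 - D) * y + th * pf y) <=
    ep (y + 1) - expR D * ((1 - D) * (y + 1) + th * pf (y + 1)).
  apply: (@is_derive_ge0_le (fun x => ep x - expR D * ((1 - D) * x + th * pf x))
    (fun x => expR (th * f x) - expR D * ((1 - D) + th * f x))).
  - by rewrite lerDl.
  - move=> x xy; have d1 := dpf x xy; have d2 := dep x xy.
    apply: is_derive_eq.
    rewrite /GRing.scale /=; ring.
  - move=> x _; rewrite subr_ge0.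
    rewrite (_ : th * f x = D + (th * f x - D)); last by ring.
    rewrite expRD; apply: ler_wpM2l; first exact: expR_ge0.
    by apply: le_trans (expR_ge1Dx _); rewrite le_eqVlt; apply/orP; left; apply/eqP; ring.
suff -> : expR D = expR D * ((1 - D) * (y + 1) + th * pf (y + 1)) -
    expR D * ((1 - D) * y + th * pf y) by lra.
by rewrite /D; ring.
Qed.

(** The sets where [u] lies in the band above [m t] cover the interval. Each has diameter at most
    [rho], hence sits in an interval of length [2 * rho] around any of its points, and [f] is at
    most the sum of the [w t] times their indicators. *)
Lemma increment_le_occupation (f pf u : R -> R) (K : nat) (m : nat -> R)
    (w : nat -> R) (rho y : R) :
  continuous f -> continuous u -> (forall x, 0 <= f x) ->
  (forall x, y <= x <= y + 1 -> is_derive x 1 pf (f x)) ->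
  0 <= rho -> (forall t, 0 <= w t) ->
  (forall x, y <= x <= y + 1 ->
    exists2 t, (t < K)%N & m t <= u x <= m t + 1 /\ f x <= w t) ->
  (forall t x x', y <= x <= y + 1 -> y <= x' <= y + 1 ->
    m t <= u x <= m t + 1 -> m t <= u x' <= m t + 1 -> `|x - x'| <= rho) ->
  pf (y + 1) - pf y <= \sum_(t < K) w t * (2 * rho).
Proof.
move=> cf cu f0 dpf rho0 w0 cover diam.
pose A t : set R := `[y, y + 1] `&` u @^-1` `[m t, m t + 1].
have mA t : measurable (A t).
  apply: measurableI => //; rewrite -[_ @^-1` _]setTI.
  by apply: (continuous_measurable_fun cu).
have A_le t : (mu (A t) <= (2 * rho)%:E)%E.
  have [->|] := eqVneq (A t) set0; first by rewrite measure0 lee_fin mulr_ge0.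
  move=> /set0P[x [xy xm]].
  apply: (@le_trans _ _ (mu `[x - rho, x + rho])).
    apply: le_measure; rewrite ?inE; [exact: mA|exact: measurable_itv|].
    move=> x' [x'y x'm].
    move: xy xm x'y x'm => /=; rewrite !in_itv/= => xy xm x'y x'm.
    by have := diam t x' x x'y xy x'm xm; rewrite ler_distl.
  by rewrite lebesgue_measure_itv/= lte_fin; case: ifP => _; rewrite lee_fin; lra.
have yy : y < y + 1 by rewrite ltrDl.
rewrite -lee_fin EFinB -(@continuous_FTC2 R f pf y (y + 1) yy); last 3 first.
- exact: continuous_subspaceT.
- split.
  + by move=> x; rewrite in_itv/= => /andP[/ltW ? /ltW ?]; case: (dpf x) => //; exact/andP.
  + apply: cvg_at_right_filter; apply: differentiable_continuous.
    by apply/derivable1_diffP; case: (dpf y) => //; rewrite lexx ltW.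
  + apply: cvg_at_left_filter; apply: differentiable_continuous.
    by apply/derivable1_diffP; case: (dpf (y + 1)) => //; rewrite lexx ltW.
- move=> x; rewrite in_itv/= => /andP[/ltW yx /ltW xy]; rewrite derive1E.
  by have [|_ ->] := dpf x; first exact/andP.
apply: (@le_trans _ _ (\int[mu]_(x in `[y, (y + 1)%R])
    (\sum_(t < K) (w t * \1_(A t) x)%R%:E))%E).
  apply: ge0_le_integral => //.
  - by move=> x _; rewrite lee_fin.
  - by apply/measurable_EFinP/measurable_funTS; exact: continuous_measurable_fun.
  - apply: emeasurable_sum => t; apply/measurable_EFinP; apply: measurable_funM => //.
    exact: (@measurable_indic _ (measurableTypeR R) R _ _ (mA t)).
  - move=> x /=; rewrite in_itv/= => xy; rewrite sumEFin lee_fin.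
    have [t tK [um fw]] := cover x xy.
    rewrite (bigD1 (Ordinal tK))//= indicE mem_set; last by split; rewrite /= in_itv.
    rewrite mulr1; apply: (le_trans fw); rewrite lerDl.
    by apply: sumr_ge0 => i _; rewrite mulr_ge0.
rewrite ge0_integral_sum//; last 2 first.
- move=> t; apply/measurable_EFinP; apply: measurable_funM => //.
  exact: (@measurable_indic _ (measurableTypeR R) R _ _ (mA t)).
- by move=> t x _; rewrite lee_fin mulr_ge0.
rewrite -sumEFin; apply: lee_sum => t _.
under eq_integral do rewrite EFinM.
rewrite ge0_integralZl//; last 2 first.
- by apply/measurable_EFinP; exact: (@measurable_indic _ (measurableTypeR R) R _ _ (mA t)).
- by rewrite lee_fin.
rewrite EFinM; apply: lee_wpmul2l; first by rewrite lee_fin.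
rewrite integral_indic//; last exact: mA.
by apply: le_trans (A_le t); apply: le_measure; rewrite ?inE;
  [apply: measurableI; [exact: mA|exact: measurable_itv]|exact: mA|exact: subIsetl].
Qed.

End real_analysis.

(** * Testing against the tent function *)

Section nodes.
Context {R : realType}.
Variable N : nat.

(** Half-integers: the cell boundaries lie midway between consecutive columns of obstacles, so each
    cell contains exactly one column. *)
Definition node (n : nat) : R := n%:R - N%:R + 2^-1.

Lemma natr_double_pred : (0 < N)%N -> (2 * N).-1%:R = 2 * N%:R - 1 :> R.
Proof.
move=> N0; have -> : 2 * N%:R = (2 * N).-1.+1%:R :> R.
  by rewrite prednK ?natrM// muln_gt0.
by rewrite -natr1; lra.
Qed.

Lemma node0 : node 0 = 2^-1 - N%:R.
Proof. by rewrite /node sub0r addrC. Qed.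

Lemma node_last : (0 < N)%N -> node (2 * N).-1 = N%:R - 2^-1.
Proof. by move=> N0; rewrite /node natr_double_pred//; lra. Qed.

Lemma node_le m n : (m <= n)%N -> node m <= node n.
Proof. by move=> mn; rewrite /node !lerD2r ler_nat. Qed.

Lemma nodeS n : node n.+1 = node n + 1.
Proof. by rewrite /node -natr1; lra. Qed.

End nodes.

Section tent_budget.
Context {R : realType}.
Variables (N : nat) (kappa F : R) (u v H G PH PG : R -> R) (x0 r0 : R).

Local Notation L := (2 * N).-1.
Local Notation inside x := ((node N 0 : R) <= x <= (node N L : R)).

Hypothesis N_gt0 : (0 < N)%N.
Hypothesis kappa_gt0 : 0 < kappa.
Hypothesis kappa_le : kappa <= 2^-1.
Hypothesis F_ge0 : 0 <= F.
Hypothesis H_ge0 : forall x, 0 <= H x.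
Hypothesis G_ge : forall x, F <= G x.
Hypothesis u_drv : forall x, inside x -> is_derive x 1 u (v x).
Hypothesis v_drv : forall x, inside x -> is_derive x 1 v (H x - G x).
Hypothesis PH_drv : forall x, inside x -> is_derive x 1 PH (H x).
Hypothesis PG_drv : forall x, inside x -> is_derive x 1 PG (G x).
Hypothesis u_ge0 : forall x, inside x -> 0 <= u x.
(** The boundary conditions in the form the tent test needs: the tangents of [u] at the outermost
    nodes, prolonged outwards by [kappa], are still nonnegative where the tent vanishes. Below, [r0]
    stands for the modulus of [x0]. *)
Hypothesis left_end : kappa * v (node N 0) <= u (node N 0).
Hypothesis right_end : 0 <= kappa * v (node N L) + u (node N L).
Hypothesis x0_le : x0 <= r0.
Hypothesis x0_ge : - r0 <= x0.
Hypothesis x0_in : r0 < N%:R - 1.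
Hypothesis u_x0 : u x0 < N%:R - 1 - r0.

Lemma x0_inside : inside x0.
Proof.
by have := x0_in; rewrite node0 (node_last N_gt0) => ?; apply/andP; split; have := x0_le; have := x0_ge; lra.
Qed.

Lemma slope_variation y z : node N 0 <= y -> y <= z -> z <= node N L ->
  - (PG z - PG y) <= v z - v y <= PH z - PH y.
Proof.
move=> y0 yz zL.
have ins x : y <= x <= z -> inside x.
  by move=> /andP[yx xz]; rewrite (le_trans y0)//= (le_trans xz).
apply/andP; split.
  have ? := F_ge0.
  suff : v y + PG y <= v z + PG z by lra.
  apply: (@is_derive_ge0_le R (fun x => v x + PG x) (fun x => H x - G x + G x)) => //.
    move=> x /ins xi; have d1 := v_drv xi; have d2 := PG_drv xi.
    exact: is_deriveD.
  by move=> x _; rewrite subrK.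
suff : PH y - v y <= PH z - v z by lra.
apply: (@is_derive_ge0_le R (fun x => PH x - v x) (fun x => H x - (H x - G x))) => //.
  move=> x /ins xi; have d1 := v_drv xi; have d2 := PH_drv xi.
  exact: is_deriveB.
by move=> x _; rewrite subKr (le_trans F_ge0).
Qed.

Lemma PH_le y z : node N 0 <= y -> y <= z -> z <= node N L -> PH y <= PH z.
Proof.
move=> y0 yz zL; apply: (@is_derive_ge0_le R PH H) => // x /andP[yx xz].
by apply: PH_drv; rewrite (le_trans y0)//= (le_trans xz).
Qed.

Lemma PG_ge y z : node N 0 <= y -> y <= z -> z <= node N L ->
  F * (z - y) <= PG z - PG y.
Proof.
move=> y0 yz zL; suff : PG y - F * y <= PG z - F * z by lra.
apply: (@is_derive_ge0_le R (fun x => PG x - F * x) (fun x => G x - F)) => //.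
  move=> x /andP[yx xz]; have d1 : is_derive x 1 PG (G x).
    by apply: PG_drv; rewrite (le_trans y0)//= (le_trans xz).
  by apply: is_derive_eq; rewrite /GRing.scale /=; ring.
by move=> x _; rewrite subr_ge0.
Qed.

Local Notation a := (node N 0 - kappa).
Local Notation b := (node N L + kappa).
Local Notation al := (x0 - a).
Local Notation be := (b - x0).

Let al_gt : N%:R - 1 - r0 <= al /\ N%:R - 1 - r0 <= be.
Proof.
rewrite node0 (node_last N_gt0).
have ? := x0_le; have ? := x0_ge; have ? := kappa_gt0; have ? := kappa_le.
by split; lra.
Qed.

Let al_gt0 : 0 < al.
Proof. by have [? _] := al_gt; have := x0_in; lra. Qed.

Let be_gt0 : 0 < be.
Proof. by have [_ ?] := al_gt; have := x0_in; lra. Qed.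

Let al_le : al <= 2 * N%:R.
Proof.
have ? := x0_le; have ? := x0_ge; have ? := kappa_gt0; have ? := kappa_le; have := x0_in; rewrite node0 => ?; lra.
Qed.

Let be_le : be <= 2 * N%:R.
Proof.
by have ? := x0_le; have ? := x0_ge; have ? := kappa_gt0; have ? := kappa_le; have := x0_in; rewrite (node_last N_gt0) => ?; lra.
Qed.

(* Primitives of [tent * u''], where [tent] is the piecewise linear function
   equal to 1 at [x0] and vanishing at both ends of the interval. *)
Let psil (x : R) := ((x - a) * v x - u x) / al + (al^-1 + be^-1) * u x0.
Let psir (x : R) := ((b - x) * v x + u x) / be.

(** The derivative of [psil] is [tent * (H - G)]; on the stretch considered the tent lies between
    [om] and [1], so this is at most [H - om * G]. *)
Let psil_step (om y z : R) : node N 0 <= y -> y <= z -> z <= x0 ->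
  om * al <= y - a ->
  psil z - psil y <= (PH z - PH y) - om * (PG z - PG y).
Proof.
move=> y0 yz zx0 omy.
suff : (PH y - om * PG y) - ((y - a) * v y - u y) / al <=
       (PH z - om * PG z) - ((z - a) * v z - u z) / al by rewrite /psil; lra.
apply: (@is_derive_ge0_le R (fun x => (PH x - om * PG x) - ((x - a) * v x - u x) / al)
  (fun x => (H x - om * G x) - (x - a) * (H x - G x) / al)) => // x /andP[yx xz].
  have xi : inside x.
    by rewrite (le_trans y0)//= (le_trans xz)// (le_trans zx0)//; case/andP: x0_inside.
  have d1 := v_drv xi; have d2 := u_drv xi; have d3 := PG_drv xi; have d4 := PH_drv xi.
  by apply: is_derive_eq; rewrite /GRing.scale /=; ring.
have -> : H x - om * G x - (x - a) * (H x - G x) / al =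
    (H x * (al - (x - a)) + G x * ((x - a) - om * al)) / al.
  by field; rewrite gt_eqF.
rewrite divr_ge0 ?(ltW al_gt0)// addr_ge0// mulr_ge0//.
- by lra.
- exact: le_trans (G_ge x).
- by lra.
Qed.

Let psir_step (om y z : R) : x0 <= y -> y <= z -> z <= node N L ->
  om * be <= b - z ->
  psir z - psir y <= (PH z - PH y) - om * (PG z - PG y).
Proof.
move=> x0y yz zL omz.
suff : (PH y - om * PG y) - ((b - y) * v y + u y) / be <=
       (PH z - om * PG z) - ((b - z) * v z + u z) / be by rewrite /psir; lra.
apply: (@is_derive_ge0_le R (fun x => (PH x - om * PG x) - ((b - x) * v x + u x) / be)
  (fun x => (H x - om * G x) - (b - x) * (H x - G x) / be)) => // x /andP[yx xz].
  have xi : inside x.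
    by rewrite (le_trans xz)// andbT (le_trans _ yx)// (le_trans _ x0y)//; case/andP: x0_inside.
  have d1 := v_drv xi; have d2 := u_drv xi; have d3 := PG_drv xi; have d4 := PH_drv xi.
  by apply: is_derive_eq; rewrite /GRing.scale /=; ring.
have -> : H x - om * G x - (b - x) * (H x - G x) / be =
    (H x * (be - (b - x)) + G x * ((b - x) - om * be)) / be.
  by field; rewrite gt_eqF.
rewrite divr_ge0 ?(ltW be_gt0)// addr_ge0// mulr_ge0//.
- by lra.
- exact: le_trans (G_ge x).
- by lra.
Qed.

(** The constant in [psil] is [u x0] times the drop of the tent's slope at the peak; it glues the
    two primitives together. *)
Let psilr : psil x0 = psir x0.
Proof.
rewrite /psil /psir; have := al_gt0; have := be_gt0 => ? ?.
by field; rewrite !gt_eqF.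
Qed.

Let psi (x : R) := if x <= x0 then psil x else psir x.

Let psi_step (om y z : R) : node N 0 <= y -> y <= z -> z <= node N L ->
  om * al <= y - a -> om * be <= b - z ->
  psi z - psi y <= (PH z - PH y) - om * (PG z - PG y).
Proof.
move=> y0 yz zL omy omz; rewrite /psi.
have [zx0|x0z] := leP z x0; first by rewrite (le_trans yz)//; exact: psil_step.
have [yx0|x0y] := leP y x0; last by apply: psir_step => //; exact: ltW.
have := @psil_step om y x0 y0 yx0 (lexx _) omy.
have := @psir_step om x0 z (lexx _) (ltW x0z) zL omz.
by rewrite psilr; lra.
Qed.

(** Both [al] and [be] are at most [2N]. Of the two relative distances in the weight, one gives the
    distance sought and the other is at most one. *)
Let weight_tent n : (n < L)%N ->
  weight kappa N n * al <= node N n - a /\ weight kappa N n * be <= b - node N n.+1.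
Proof.
move=> nL; have N1 : 1 <= N%:R :> R by rewrite ler1n.
have w0 : 0 <= weight kappa N n by exact/ltW/weight_gt0.
have nL1 : n.+1%:R <= 2 * N%:R - 1 :> R by rewrite -(natr_double_pred N_gt0) ler_nat.
have n0 : 0 <= n%:R :> R by [].
have E : weight kappa N n * (2 * N%:R) =
    kappa * (n.+1%:R * (2 * N%:R - 1 - n%:R)) / (2 * N%:R).
  rewrite /weight (natrB _ (ltnW nL)) (natr_double_pred N_gt0); field.
  by rewrite gt_eqF// ltr0n.
have ? := kappa_gt0; have ? := kappa_le.
split.
  apply: (le_trans (ler_wpM2l w0 al_le)); rewrite E ler_pdivrMr ?mulr_gt0 ?ltr0n//.
  rewrite mulrA; apply: ler_pM; rewrite ?mulr_ge0 ?(ltW kappa_gt0)//.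
  - by move: nL1; rewrite -[n.+1%:R]natr1; lra.
  - rewrite node0 /node; move: nL1; rewrite -[n.+1%:R]natr1 => nL1.
    have : kappa * n%:R <= 1 * n%:R by apply: ler_wpM2r => //; lra.
    by lra.
  - by lra.
apply: (le_trans (ler_wpM2l w0 be_le)); rewrite E ler_pdivrMr ?mulr_gt0 ?ltr0n//.
rewrite [n.+1%:R * _]mulrC mulrA.
apply: ler_pM; rewrite ?mulr_ge0 ?(ltW kappa_gt0)//.
- by move: nL1; rewrite -[n.+1%:R]natr1; lra.
- rewrite (node_last N_gt0) /node; move: nL1; rewrite -[n.+1%:R]natr1 => nL1.
  have : kappa * (2 * N%:R - 2 - n%:R) <= 1 * (2 * N%:R - 2 - n%:R).
    by apply: ler_wpM2r; lra.
  by lra.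
- by lra.
Qed.

(** The increments of [psi] telescope. At the right end [psi] is nonnegative; at the left end it is
    at most [u x0 / al + u x0 / be], and this is where the lowness of [u] at [x0] enters: [u x0] is
    below both distances, hence the constant [2]. *)
Lemma tent_budget :
  \sum_(n < L) weight kappa N n * (PG (node N n.+1) - PG (node N n)) <=
  2 + \sum_(n < L) (PH (node N n.+1) - PH (node N n)).
Proof.
have step n : (n < L)%N -> weight kappa N n * (PG (node N n.+1) - PG (node N n)) <=
    (PH (node N n.+1) - PH (node N n)) - (psi (node N n.+1) - psi (node N n)).
  move=> nL; have [w1 w2] := weight_tent nL.
  have := @psi_step (weight kappa N n) (node N n) (node N n.+1) (node_le N (leq0n n))
    (node_le N (leqnSn n)) (node_le N nL) w1 w2.
  lra.
apply: (@le_trans _ _ (\sum_(n < L) ((PH (node N n.+1) - PH (node N n))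
    - (psi (node N n.+1) - psi (node N n))))).
  by apply: ler_sum => n _; exact: step.
rewrite big_split /= addrC lerD2r sumrN.
have tel : \sum_(n < L) (psi (node N n.+1) - psi (node N n)) =
    psi (node N L) - psi (node N 0).
  have := telescope_sumr (fun n => psi (node N n)) (leq0n L).
  by rewrite big_mkord.
rewrite tel opprB; have /andP[x00 x0L] := x0_inside.
have [al1 be1] := al_gt.
have h1 : u x0 / al <= 1 by rewrite ler_pdivrMr// mul1r; have := u_x0; lra.
have h2 : u x0 / be <= 1 by rewrite ler_pdivrMr// mul1r; have := u_x0; lra.
have pl : psi (node N 0) <= 2.
  rewrite /psi x00 /psil.
  have : ((node N 0 - a) * v (node N 0) - u (node N 0)) / al <= 0.
    rewrite ler_pdivrMr// mul0r (_ : node N 0 - a = kappa); last by lra.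
    by rewrite subr_le0.
  lra.
have pr : 0 <= psi (node N L).
  have : 0 <= psir (node N L).
    rewrite /psir divr_ge0 ?(ltW be_gt0)// (_ : b - node N L = kappa)//.
    by lra.
  rewrite /psi; case: ifP => // Lx0; have -> : node N L = x0 by apply/le_anti/andP.
  by rewrite psilr.
lra.
Qed.

Let total := \sum_(n < L) ((PH (node N n.+1) - PH (node N n)) +
                          (PG (node N n.+1) - PG (node N n))).

Lemma total_variation y z : inside y -> inside z -> `|v z - v y| <= total.
Proof.
wlog yz : y z / y <= z.
  move=> W iy iz; have [yz|/ltW zy] := leP y z; first exact: W.
  by rewrite distrC; exact: W.
move=> /andP[y0 yL] /andP[z0 zL].
have /andP[v1 v2] := slope_variation y0 yz zL.
have totE : total = (PH (node N L) + PG (node N L)) - (PH (node N 0) + PG (node N 0)).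
  have := telescope_sumr (fun n => PH (node N n) + PG (node N n)) (leq0n L).
  by rewrite big_mkord => <-; apply: eq_bigr => i _; ring.
have ? := PH_le (lexx _) y0 yL.
have ? := PH_le y0 yz zL.
have ? := PH_le z0 zL (lexx _).
have ? := PG_ge (lexx _) y0 yL.
have ? := PG_ge y0 yz zL.
have ? := PG_ge z0 zL (lexx _).
have ? : 0 <= F * (y - node N 0) by rewrite mulr_ge0// subr_ge0.
have ? : 0 <= F * (z - y) by rewrite mulr_ge0// subr_ge0.
have ? : 0 <= F * (node N L - z) by rewrite mulr_ge0// subr_ge0.
by rewrite totE ler_norml; apply/andP; split; lra.
Qed.

Let sub_inside y z : inside y -> inside z -> forall x, y <= x <= z -> inside x.
Proof.
by move=> /andP[y0 _] /andP[_ zL] x /andP[yx xz]; rewrite (le_trans y0)//= (le_trans xz).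
Qed.

Let node0_inside : inside (node N 0 : R).
Proof. by rewrite lexx node_le. Qed.

Let nodeL_inside : inside (node N L : R).
Proof. by rewrite lexx node_le. Qed.

(** As [u] is nonnegative and [u x0] is below the distance from [x0] to either end node, the mean
    slopes on the two sides of [x0] are bounded above and below; the slope at the first node differs
    from them by at most [total]. This limits the initial states in the union bound. *)
Lemma initial_slope_le : `|v (node N 0)| <= 2 + total.
Proof.
have /andP[x00 x0L] := x0_inside.
have ux0 := u_ge0 x0_inside.
have := x0_in; have := u_x0; have n1 := x0_le; have n2 := x0_ge => n3 n4.
have [|c1 /andP[c1a c1b] E1] := @is_derive_MVT R u v (node N 0) x0 x00.
  by move=> x /(sub_inside node0_inside x0_inside); exact: u_drv.
have [|c2 /andP[c2a c2b] E2] := @is_derive_MVT R u v x0 (node N L) x0L.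
  by move=> x /(sub_inside x0_inside nodeL_inside); exact: u_drv.
have ic1 : inside c1 by rewrite c1a (le_trans c1b).
have ic2 : inside c2 by rewrite c2b andbT (le_trans _ c2a).
have u0 := u_ge0 node0_inside; have uL := u_ge0 nodeL_inside.
have d1 : 2^-1 <= x0 - node N 0 by rewrite node0; lra.
have d2 : 2^-1 <= node N L - x0 by rewrite (node_last N_gt0); lra.
have s1 : v c1 <= 2.
  suff : v c1 * (x0 - node N 0) <= 2 * (x0 - node N 0) by rewrite ler_pM2r//; lra.
  by have e0 := @node0 R N; rewrite -E1; lra.
have s2 : - 2 <= v c2.
  suff : (- 2) * (node N L - x0) <= v c2 * (node N L - x0) by rewrite ler_pM2r//; lra.
  by have eL := @node_last R N N_gt0; rewrite -E2; lra.
have := total_variation node0_inside ic1; have := total_variation node0_inside ic2.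
rewrite !ler_norml => /andP[? ?] /andP[? ?]; apply/andP; split; lra.
Qed.

Lemma initial_height_le : u (node N 0) <= 5 * N%:R + 4 * N%:R * total.
Proof.
have /andP[x00 x0L] := x0_inside.
have := x0_in; have := u_x0; have n1 := x0_le; have n2 := x0_ge => n3 n4.
have [|c1 /andP[c1a c1b] E1] := @is_derive_MVT R u v (node N 0) x0 x00.
  by move=> x /(sub_inside node0_inside x0_inside); exact: u_drv.
have ic1 : inside c1 by rewrite c1a (le_trans c1b).
have := total_variation node0_inside ic1; have := initial_slope_le.
have t0 : 0 <= total by apply: le_trans (total_variation node0_inside ic1).
rewrite !ler_norml => /andP[? ?] /andP[? ?].
have c1l : - (2 + 2 * total) <= v c1 by lra.
have dx : x0 - node N 0 <= 2 * N%:R by rewrite node0; lra.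
have : - (2 + 2 * total) * (x0 - node N 0) <= v c1 * (x0 - node N 0).
  by apply: ler_wpM2r => //; rewrite subr_ge0.
have : (2 + 2 * total) * (x0 - node N 0) <= (2 + 2 * total) * (2 * N%:R).
  by apply: ler_wpM2l => //; lra.
lra.
Qed.

End tent_budget.

(** * Exponential moment of the slope gained in one cell *)

Section cell_occupation.
Context {R : realType}.

Lemma absz_intr (s : int) : `|s|%N%:R = `|s%:~R : R|.
Proof. by rewrite natr_absz intr_norm. Qed.

Lemma floor_near (r : R) (h : int) (m : nat) :
  h%:~R - m%:R <= r -> r < h%:~R + m%:R + 1 -> (`|Num.floor r - h| <= m)%N.
Proof.
move=> r1 r2.
have : h - m%:Z <= Num.floor r by rewrite floor_ge_int intrB.
have : Num.floor r < h + m%:Z + 1 by rewrite floor_lt_int !intrD.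
by lia.
Qed.

Lemma window_index (f h : int) (m : nat) : (`|f - h| <= m)%N ->
  exists2 t : nat, (t < 2 * m + 1)%N & h - m%:Z + t%:Z = f.
Proof. by move=> fhm; exists `|(f - (h - m%:Z))%R|%N; lia. Qed.

Variables (u v H PH : R -> R) (y th : R) (c : int -> R) (s h : int) (V : nat).
Hypothesis u_cont : continuous u.
Hypothesis H_cont : continuous H.
Hypothesis th_ge0 : 0 <= th.
Hypothesis u_drv : forall x, y <= x <= y + 1 -> is_derive x 1 u (v x).
Hypothesis PH_drv : forall x, y <= x <= y + 1 -> is_derive x 1 PH (H x).
Hypothesis v_s : forall x, y <= x <= y + 1 -> `|v x - s%:~R| <= V%:R + 1.
Hypothesis u_h : h%:~R <= u y < (h + 1)%:~R.
Hypothesis H_le : forall x, y <= x <= y + 1 -> H x <= c (Num.floor (u x)).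

Let S : R := `|s|%N%:R.

Let increment x x' : y <= x -> x <= x' -> x' <= y + 1 ->
  exists2 w, `|w - s%:~R| <= V%:R + 1 & u x' - u x = w * (x' - x).
Proof.
move=> yx xx' x'y; have [|z /andP[xz zx'] E] := @is_derive_MVT R u v x x' xx'.
  by move=> z /andP[xz zx']; apply: u_drv; rewrite (le_trans yx)//= (le_trans zx').
by exists (v z) => //; apply: v_s; rewrite (le_trans yx)//= (le_trans zx').
Qed.

(** If [|s|] is at most [2V + 1], the unit length of the cell is already small enough. Otherwise the
    slope keeps modulus at least [|s| / 2], so a band of height one is crossed within time
    [2 / |s|]. *)
Let occupation_diam m x x' : y <= x <= y + 1 -> y <= x' <= y + 1 ->
  m <= u x <= m + 1 -> m <= u x' <= m + 1 ->
  `|x - x'| <= 4 * (1 + V%:R) / (1 + S).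
Proof.
wlog xx' : x x' / x <= x'.
  move=> W ix ix' ux ux'; have [xx'|/ltW x'x] := leP x x'; first exact: W.
  by rewrite distrC; exact: W.
move=> /andP[yx xy] /andP[yx' xy'] /andP[ux1 ux2] /andP[ux'1 ux'2].
have S0 : 0 <= S by [].
have V0 : 0 <= V%:R :> R by [].
rewrite distrC ger0_norm ?subr_ge0// ler_pdivlMr; last by lra.
have [sV|Vs] := leqP `|s|%N (2 * V + 1)%N.
  have : S <= (2 * V + 1)%N%:R by rewrite ler_nat.
  rewrite (natrD _ (2 * V)) natrM => SV.
  have : x' - x <= 1 by lra.
  have : 0 <= x' - x by lra.
  by nra.
have SV : 2 * V%:R + 2 <= S.
  have : (2 * V + 2)%N%:R <= S by rewrite ler_nat (leq_trans _ Vs)// addn2 addn1.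
  by rewrite (natrD _ (2 * V)) natrM.
have [w ws E] := increment yx xx' xy'.
have Sw : S / 2 <= `|w|.
  have : S <= `|w| + `|w - s%:~R|.
    by rewrite /S absz_intr distrC -{1}(subrK w s%:~R) addrC ler_normD.
  by lra.
have d1 : `|w| * (x' - x) <= 1.
  rewrite -[x' - x]ger0_norm ?subr_ge0// -normrM -E ler_norml.
  by apply/andP; split; lra.
have d0 : 0 <= x' - x by lra.
have : S / 2 * (x' - x) <= `|w| * (x' - x) by exact: ler_wpM2r.
have : (x' - x) * 2 <= S * (x' - x) by rewrite mulrC; apply: ler_wpM2r => //; lra.
by lra.
Qed.

(** Jensen's inequality, then the occupation bound for [expR (th * H)]. The path moves by at most
    [|s| + V + 1], hence its integer height by at most [|s| + V + 2], which leaves [2|s| + 2V + 5]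
    possible heights. *)
Lemma cell_occupation :
  expR (th * (PH (y + 1) - PH y)) <= 8 * (1 + V%:R) / (1 + S) *
    \sum_(t < 2 * `|s|%N + 2 * V + 5)
      expR (th * c (h - (`|s|%N + V + 2)%N%:Z + t%:Z)).
Proof.
have S0 : 0 <= S by [].
have V0 : 0 <= V%:R :> R by [].
pose e x := expR (th * H x).
have ce : continuous e.
  move=> x; apply: continuous_comp; last exact: continuous_expR.
  by apply: continuousM; [exact: cst_continuous|exact: H_cont].
have [ep dep] := continuous_antiderivative (y - 1) ce.
have {}dep x : y <= x <= y + 1 -> is_derive x 1 ep (e x).
  by move=> /andP[yx _]; apply: dep; lra.
apply: (le_trans (jensen_expR PH_drv dep)).
pose m (t : nat) : R := (h - (`|s|%N + V + 2)%N%:Z + t%:Z)%:~R.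
pose w (t : nat) := expR (th * c (h - (`|s|%N + V + 2)%N%:Z + t%:Z)).
have rho0 : 0 <= 4 * (1 + V%:R) / (1 + S).
  by rewrite divr_ge0 ?mulr_ge0// addr_ge0.
apply: (le_trans (@increment_le_occupation R e ep u (2 * `|s|%N + 2 * V + 5) m w
  (4 * (1 + V%:R) / (1 + S)) y ce u_cont _ dep rho0 _ _ _)).
- by move=> x; exact: expR_ge0.
- by move=> t; exact: expR_ge0.
- move=> x xy; have /andP[yx xy1] := xy.
  have [z zs E] := increment (lexx _) yx xy1.
  have z1 : `|u x - u y| <= S + V%:R + 1.
    rewrite E normrM; have : `|z| <= S + V%:R + 1.
      by rewrite /S absz_intr -(subrK s%:~R z) (le_trans (ler_normD _ _))// addrC; lra.
    have : `|x - y| <= 1 by rewrite ger0_norm ?subr_ge0//; lra.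
    have := normr_ge0 z; have := normr_ge0 (x - y); nra.
  have /andP[h1 h2] := u_h; rewrite intrD in h2.
  move: z1; rewrite ler_norml => /andP[z1 z2].
  have near : (`|Num.floor (u x) - h| <= `|s|%N + V + 2)%N.
    by apply: floor_near; rewrite !natrD -/S; lra.
  have [t tm tE] := window_index near.
  exists t; first by rewrite (leq_trans tm)// !mulnDr -addnA.
  rewrite /m /w /e tE; split; last by rewrite ler_expR ler_wpM2l// H_le.
  have /andP[-> /ltW] := floor_itv (u x); by rewrite intrD.
- by move=> t x x'; exact: occupation_diam.
rewrite le_eqVlt; apply/orP; left; apply/eqP.
rewrite -mulr_suml mulrC; congr (_ * _); field; rewrite gt_eqF//; lra.
Qed.

End cell_occupation.

(** * Discretisation of a path *)

(* An upper bound for the exponential of the slope gained in a cell entered at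
   height [h] with slope [s], when [V] bounds the slope variation there and
   [c m] is the strength of the obstacle at height [m]; the first factor is the
   price [expR (- r V)] of that variation. *)
Definition cell_factor {R : realType} (r : R) (c : int -> R) (h s : int) (V : nat) : R :=
  expR (- (r * V%:R)) * (8 * (1 + V%:R) / (1 + `|s|%N%:R)) *
  \sum_(t < 2 * `|s|%N + 2 * V + 5) expR (c (h - (`|s|%N + V + 2)%N%:Z + t%:Z)).

Section path_discretization.
Context {R : realType}.
Variables (N : nat) (kappa F th : R) (u v H G : R -> R) (x0 r0 : R).
Variable c : nat -> int -> R.

Local Notation L := (2 * N).-1.
Local Notation inside x := ((node N 0 : R) <= x <= (node N L : R)).

Hypothesis N_gt0 : (0 < N)%N.
Hypothesis kappa_gt0 : 0 < kappa.
Hypothesis kappa_le : kappa <= 2^-1.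
Hypothesis F_ge0 : 0 <= F.
Hypothesis th_gt0 : 0 < th.
Hypothesis th_le1 : th <= 1.
Hypothesis u_cont : continuous u.
Hypothesis H_cont : continuous H.
Hypothesis G_cont : continuous G.
Hypothesis H_ge0 : forall x, 0 <= H x.
Hypothesis G_ge : forall x, F <= G x.
Hypothesis u_drv : forall x, inside x -> is_derive x 1 u (v x).
Hypothesis v_drv : forall x, inside x -> is_derive x 1 v (H x - G x).
Hypothesis u_ge0 : forall x, inside x -> 0 <= u x.
Hypothesis left_end : kappa * v (node N 0) <= u (node N 0).
Hypothesis right_end : 0 <= kappa * v (node N L) + u (node N L).
Hypothesis x0_le : x0 <= r0.
Hypothesis x0_ge : - r0 <= x0.
Hypothesis x0_in : r0 < N%:R - 1.
Hypothesis u_x0 : u x0 < N%:R - 1 - r0.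
Hypothesis H_le : forall n x, (n < L)%N -> node N n <= x <= node N n.+1 ->
  H x <= c n (Num.floor (u x)).

Let nodeB n : node N n.+1 - node N n = 1 :> R.
Proof. by rewrite nodeS; lra. Qed.

Lemma discretized_path : exists (h s : nat -> int) (V : nat -> nat),
  [/\ 0 <= h 0%N,
      forall n, (n < L)%N -> (`|s n.+1 - s n| <= V n + 2)%N /\
                             (`|(h n.+1 - (h n + s n))%R| <= V n + 2)%N &
      1 <= expR (5 * N%:R) * expR (- (th * kappa * F / 16 * N%:R)) *
           expR (- (th * kappa / 80 / N%:R * `|s 0%N|%N%:R)) *
           expR (- (th * kappa / 80 / N%:R ^+ 2 * `|h 0%N|%N%:R)) *
           \prod_(n < L) cell_factor (th / 2 * weight kappa N n)
             (fun m => 2 * th * c n m) (h n) (s n) (V n)].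
Proof.
(* The base point is strictly left of the first node, so that the primitive is differentiable at
   that node as well. *)
have [PH dPH'] := continuous_antiderivative (node N 0 - 1) H_cont.
have [PG dPG'] := continuous_antiderivative (node N 0 - 1) G_cont.
have dPH x : inside x -> is_derive x 1 PH (H x).
  by move=> /andP[x1 _]; apply: dPH'; lra.
have dPG x : inside x -> is_derive x 1 PG (G x).
  by move=> /andP[x1 _]; apply: dPG'; lra.
pose D n := PH (node N n.+1) - PH (node N n).
pose Ga n := PG (node N n.+1) - PG (node N n).
have nodes n : (n < L)%N -> [/\ node N 0 <= node N n :> R,
    node N n <= node N n.+1 :> R & node N n.+1 <= node N L :> R].
  by move=> nL; split; apply: node_le.
have D0 n : (n < L)%N -> 0 <= D n.
  by move=> /nodes[n0 nn nL]; rewrite subr_ge0; apply: (PH_le H_ge0 dPH).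
have GaF n : (n < L)%N -> F <= Ga n.
  move=> /nodes[n0 nn nL].
  by have := PG_ge G_ge dPG n0 nn nL; rewrite nodeB mulr1.
pose V n := (Num.truncn (D n + Ga n)).+1.
have VDG n : (n < L)%N -> D n + Ga n <= (V n)%:R <= D n + Ga n + 1.
  move=> nL; have dg0 : 0 <= D n + Ga n.
    by rewrite addr_ge0 ?D0// (le_trans F_ge0) ?GaF.
  have /andP[t1 t2] := truncn_itv dg0.
  by rewrite (ltW t2)/= -natr1 lerD2r.
pose s n := Num.floor (v (node N n)).
pose h n := Num.floor (u (node N n)).
have v_near n x : (n < L)%N -> node N n <= x <= node N n.+1 ->
    `|v x - v (node N n)| <= (V n)%:R.
  move=> nL /andP[nx xn]; have [n0 nn nL'] := nodes n nL.
  have /andP[v1 v2] := slope_variation F_ge0 H_ge0 G_ge v_drv dPH dPG n0 nx (le_trans xn nL').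
  have /andP[V1 _] := VDG n nL.
  have xi0 : node N 0 <= x by apply: le_trans nx.
  have := PH_le H_ge0 dPH xi0 xn nL'; have := D0 n nL.
  have := PG_ge G_ge dPG xi0 xn nL'; have := GaF n nL.
  have : 0 <= F * (node N n.+1 - x) by rewrite mulr_ge0// subr_ge0.
  move: V1; rewrite /D /Ga => *; have F0 := F_ge0.
  by rewrite ler_norml; apply/andP; split; lra.
have v_s n x : (n < L)%N -> node N n <= x <= node N n.+1 ->
    `|v x - (s n)%:~R| <= (V n)%:R + 1.
  move=> nL xn; have := v_near n x nL xn; rewrite !ler_norml => /andP[a1 a2].
  have /andP[s1 s2] := floor_itv (v (node N n)); rewrite intrD in s2.
  by apply/andP; rewrite /s; split; lra.
have N0 : 0 < N%:R :> R by rewrite ltr0n.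
have k0 := kappa_gt0; have k1 := kappa_le; have F0 := F_ge0.
have t0 := th_gt0; have t1 := th_le1.
exists h, s, V; split.
- by rewrite /h floor_ge_int u_ge0// lexx node_le.
- move=> n nL; have [n0 nn nL'] := nodes n nL.
  have /andP[s1 s2] := floor_itv (v (node N n)); rewrite intrD in s2.
  have /andP[h1 h2] := floor_itv (u (node N n)); rewrite intrD in h2.
  split.
    have := v_near n (node N n.+1) nL; rewrite lexx nn => /(_ isT).
    rewrite ler_norml => /andP[a1 a2].
    by apply: floor_near; rewrite !natrD /s; lra.
  have [|x xn E] := @is_derive_MVT R u v (node N n) (node N n.+1) nn.
    by move=> x /andP[x1 x2]; apply: u_drv; rewrite (le_trans n0)//= (le_trans x2).
  have := v_s n x nL xn; rewrite ler_norml => /andP[a1 a2].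
  rewrite nodeB mulr1 in E.
  by apply: floor_near; rewrite !natrD !intrD /h; lra.
pose Y n := (8 * (1 + (V n)%:R) / (1 + `|s n|%N%:R)) *
    \sum_(t < 2 * `|s n|%N + 2 * V n + 5)
      expR (2 * th * c n (h n - (`|s n|%N + V n + 2)%N%:Z + t%:Z)).
have YD n : (n < L)%N -> expR (2 * th * D n) <= Y n.
  move=> nL; have [n0 nn nL'] := nodes n nL; rewrite /D nodeS /Y.
  apply: (@cell_occupation R u v H PH) => //.
  - lra.
  - move=> x /andP[x1 x2]; apply: u_drv.
    by rewrite (le_trans n0)//= (le_trans x2)// -nodeS.
  - move=> x /andP[x1 x2]; apply: dPH.
    by rewrite (le_trans n0)//= (le_trans x2)// -nodeS.
  - by move=> x xn; apply: v_s => //; rewrite nodeS.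
  - exact: floor_itv.
  - by move=> x xn; apply: H_le => //; rewrite nodeS.
pose W := \sum_(n < L) weight kappa N n * (V n)%:R.
pose S := \sum_(n < L) D n.
have om0 n : (n < L)%N -> 0 <= weight kappa N n by move=> nL; exact/ltW/weight_gt0.
have om1 n : (n < L)%N -> weight kappa N n <= 1.
  by move=> nL; apply: weight_le1 => //; apply/andP; split; lra.
(* One [S] comes from the tent budget for [Ga], the other from bounding the weight of [D n + 1] by
   one; hence the doubled exponent in [YD]. *)
have WS : W <= 2 * S + 2 * N%:R + 1.
  have B : \sum_(n < L) weight kappa N n * Ga n <= 2 + S := tent_budget N_gt0 kappa_gt0 kappa_le F_ge0 H_ge0 G_ge u_drv v_drv dPH dPG
    left_end right_end x0_le x0_ge x0_in u_x0.
  apply: (@le_trans _ _ (\sum_(n < L) (weight kappa N n * Ga n + (D n + 1)))).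
    apply: ler_sum => n _; have nL := ltn_ord n; have /andP[_ V2] := VDG n nL.
    apply: (le_trans (ler_wpM2l (om0 n nL) V2)).
    have -> : weight kappa N n * (D n + Ga n + 1) =
      weight kappa N n * Ga n + weight kappa N n * (D n + 1) by ring.
    rewrite lerD2l ler_piMl ?om1// addr_ge0 ?D0//.
  rewrite big_split [X in _ + X <= _]big_split /= sumr_const card_ord (natr_double_pred N_gt0) -/S.
  by lra.
have WF : F * (kappa * N%:R / 4) <= W.
  apply: (le_trans (ler_wpM2l F_ge0 (sum_weight_ge (ltW kappa_gt0) N_gt0))).
  rewrite mulr_sumr; apply: ler_sum => n _; have nL := ltn_ord n.
  rewrite mulrC ler_wpM2l ?om0//; have /andP[V1 _] := VDG n nL.
  by rewrite (le_trans _ V1)// (le_trans (GaF n nL))// lerDr D0.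
pose tot := \sum_(n < L) (D n + Ga n).
have totW : kappa * tot <= 4 * N%:R * W.
  rewrite /tot /W !mulr_sumr; apply: ler_sum => n _; have nL := ltn_ord n.
  have /andP[V1 _] := VDG n nL.
  have w1 := weight_ge (ltW kappa_gt0) N_gt0 nL.
  have w2 : kappa <= 4 * N%:R * weight kappa N n.
    by rewrite -ler_pdivrMl ?mulr_gt0// mulrC.
  rewrite mulrA; apply: ler_pM => //; first exact: ltW.
  by rewrite addr_ge0 ?D0// (le_trans F_ge0) ?GaF.
(* The smallest weights are of order [1 / N], so [W] controls the total variation only up to a
   factor [N]. The natural scales are therefore [N] for the initial slope and [N^2] for the initial
   height. *)
have hs : kappa / 20 * (`|s 0%N|%N%:R / N%:R + `|h 0%N|%N%:R / N%:R ^+ 2) <= W + 4^-1.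
  have i1 : `|v (node N 0)| <= 2 + tot := initial_slope_le N_gt0 F_ge0 H_ge0 G_ge u_drv v_drv dPH dPG u_ge0 x0_le x0_ge x0_in u_x0.
  have i2 : u (node N 0) <= 5 * N%:R + 4 * N%:R * tot := initial_height_le N_gt0 F_ge0 H_ge0 G_ge u_drv v_drv dPH dPG u_ge0 x0_le x0_ge x0_in u_x0.
  have sb : `|s 0%N|%N%:R <= 3 + tot.
    have /andP[s1 s2] := floor_itv (v (node N 0)); rewrite intrD in s2.
    rewrite absz_intr ler_norml; move: i1; rewrite ler_norml => /andP[? ?].
    by apply/andP; rewrite /s; split; lra.
  have hb : `|h 0%N|%N%:R <= 5 * N%:R + 4 * N%:R * tot.
    have /andP[h1 h2] := floor_itv (u (node N 0)).
    rewrite absz_intr ger0_norm; first by rewrite (le_trans h1).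
    by rewrite ler0z floor_ge_int u_ge0// lexx node_le.
  have n1 : 1 <= N%:R :> R by rewrite ler1n.
  have sb' : kappa * (`|s 0%N|%N%:R / N%:R) <= 3 * kappa + 4 * W.
    rewrite mulrA ler_pdivrMr//.
    apply: (le_trans (ler_wpM2l (ltW kappa_gt0) sb)).
    have : 0 <= kappa * (N%:R - 1) by rewrite mulr_ge0// ?subr_ge0// ltW.
    by move: totW; lra.
  have hb' : kappa * (`|h 0%N|%N%:R / N%:R ^+ 2) <= 5 * kappa + 16 * W.
    rewrite mulrA ler_pdivrMr ?exprn_gt0//.
    apply: (le_trans (ler_wpM2l (ltW kappa_gt0) hb)).
    have : 0 <= kappa * (N%:R * (N%:R - 1)).
      by rewrite mulr_ge0 ?mulr_ge0// ?subr_ge0// ltW.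
    have : 4 * N%:R * (kappa * tot) <= 4 * N%:R * (4 * N%:R * W).
      by rewrite ler_wpM2l// mulr_ge0// ltW.
    lra.
  lra.
rewrite (_ : \prod_(n < L) _ = expR (- (th / 2 * W)) * \prod_(n < L) Y n); last first.
  rewrite /W mulr_sumr -sumrN expR_sum -big_split /=; apply: eq_bigr => n _.
  by rewrite /Y /cell_factor !mulrA.
have PY : expR (2 * th * S) <= \prod_(n < L) Y n.
  rewrite /S mulr_sumr expR_sum; apply: ler_prod => n _.
  by rewrite expR_ge0 YD.
rewrite mulrA; apply: (le_trans _ (ler_wpM2l _ PY)); last by rewrite !mulr_ge0 ?expR_ge0.
(* The term [2 * th * S] supplies [th * W] up to order [N]: one half is the price in the cell
   factors, one quarter gives the gain in [F], one quarter the damping of the initial state, and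
   [5 * N] absorbs the rest. *)
rewrite -!expRD -[leLHS]expR0 ler_expR.
have e1 : th * (kappa / 20 * (`|s 0%N|%N%:R / N%:R + `|h 0%N|%N%:R / N%:R ^+ 2)) <=
    th * (W + 4^-1) by rewrite ler_wpM2l// ltW.
have e2 : th * (F * (kappa * N%:R / 4)) <= th * W by rewrite ler_wpM2l// ltW.
have e3 : th * W <= th * (2 * S + 2 * N%:R + 1) by rewrite ler_wpM2l// ltW.
have e4 : th * (2 * N%:R + 2) <= 1 * (2 * N%:R + 2) by rewrite ler_wpM2r// addr_ge0// mulr_ge0.
have n1 : 1 <= N%:R :> R by rewrite ler1n.
have -> : th * kappa / 80 / N%:R * `|s 0%N|%N%:R = th * (kappa / 20 * (`|s 0%N|%N%:R / N%:R)) / 4.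
  by field; rewrite gt_eqF.
have -> : th * kappa / 80 / N%:R ^+ 2 * `|h 0%N|%N%:R = th * (kappa / 20 * (`|h 0%N|%N%:R / N%:R ^+ 2)) / 4.
  by field; rewrite gt_eqF.
lra.
Qed.

End path_discretization.

(** * Low solutions of the Dirichlet problem *)

Section continuity.
Context {R : realType}.

Lemma continuous_sumr (I : Type) (r : seq I) (f : I -> R -> R) :
  (forall i, continuous (f i)) -> continuous (fun x => \sum_(i <- r) f i x).
Proof.
move=> cf; elim: r => [|i r IH].
  by under eq_fun do rewrite big_nil; exact: cst_continuous.
under eq_fun do rewrite big_cons.
by move=> x; apply: continuousD; [exact: cf|exact: IH].
Qed.

Lemma continuous_uncurried (f : R -> R -> R) (p q : R -> R) :
  continuous (fun z : R * R => f z.1 z.2) -> continuous p -> continuous q ->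
  continuous (fun x => f (p x) (q x)).
Proof.
by move=> cf cp cq x; apply: continuous2_cvg; [exact: (cf (p x, q x))|exact: cp|exact: cq].
Qed.

Lemma bump_bounded (phi : R -> R -> R) (del : R) :
  continuous (fun z : R * R => phi z.1 z.2) ->
  (forall x s, phi x s != 0 -> `|x| <= del /\ `|s| <= del) ->
  exists2 B : R, 0 < B & forall x s, phi x s <= B.
Proof.
move=> cphi supp.
have [del0|del0] := leP 0 del; last first.
  exists 1 => // x s; have [->//|/supp[+ _]] := eqVneq (phi x s) 0.
  by move=> xd; have := le_lt_trans xd del0; rewrite normr_lt0.
pose A : set (R * R) := `[- del, del] `*` `[- del, del].
have [|||c _ cmax] := @compact_EVT_max _ R (fun z : R * R => phi z.1 z.2) A.
- by exists (0, 0); split; rewrite /= in_itv/= oppr_le0 del0.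
- by apply: compact_setX; exact: segment_compact.
- exact: continuous_subspaceT.
exists (Num.max 1 (phi c.1 c.2)); first by rewrite lt_max ltr01.
move=> x s; rewrite le_max.
have [->|/supp[xd sd]] := eqVneq (phi x s) 0; first by rewrite ler01.
apply/orP; right; apply: (cmax (x, s)); rewrite inE; split.
  by rewrite /= in_itv/= -ler_norml.
by rewrite /= in_itv/= -ler_norml.
Qed.

End continuity.

Definition lattice_box (K : nat) : seq (int * int) :=
  [seq (p%:Z - K%:Z, q%:Z - K%:Z) | p <- iota 0 (2 * K + 1), q <- iota 0 (2 * K + 1)].

Lemma lattice_box_uniq K : uniq (lattice_box K).
Proof.
apply: allpairs_uniq; [exact: iota_uniq|exact: iota_uniq|].
by move=> [p q] [p' q'] _ _ /= [pp qq]; congr (_, _); lia.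
Qed.

Lemma mem_lattice_box K (k : int * int) : (`|k.1| <= K)%N -> (`|k.2| <= K)%N ->
  k \in lattice_box K.
Proof.
case: k => i m /= iK mK; apply/allpairsP.
exists (`|(i + K%:Z)%R|%N, `|(m + K%:Z)%R|%N); rewrite !mem_iota /=; split; [lia|lia|].
by congr (_, _); lia.
Qed.

Section bad_solution.
Context {R : realType}.
Variables (delta F Phi : R) (phi g : R -> R -> R) (lw : int * int -> R).
Variables (N : nat) (u : R -> R) (x0 : R).

Hypothesis delta_bounds : 0 < delta < 2^-1.
Hypothesis phi_cont : continuous (fun z : R * R => phi z.1 z.2).
Hypothesis phi_ge0 : forall x s, 0 <= phi x s.
Hypothesis phi_supp : forall x s, phi x s != 0 -> `|x| <= delta /\ `|s| <= delta.
Hypothesis phi_le : forall x s, phi x s <= Phi.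
Hypothesis g_cont : continuous (fun z : R * R => g z.1 z.2).
Hypothesis g_ge0 : forall x s, 0 <= g x s.
Hypothesis F_ge0 : 0 <= F.
Hypothesis N_gt0 : (0 < N)%N.

Local Notation a := (- N%:R + delta).
Local Notation b := (N%:R - delta).
Local Notation L := (2 * N).-1.
(** [kappa] is the distance from an end of the interval to the nearest node. The argument is
    pathwise: a single realisation [lw] is seen as a field over a one-point sample space. *)
Local Notation kappa := (2^-1 - delta).
Local Notation f := (fun x s => rfield g phi (fun k (_ : unit) => lw k) x s tt).

Hypothesis u_sol : dirichlet_solution f F a b u.
Hypothesis u_nonneg : forall x, a <= x <= b -> 0 <= u x.
Hypothesis x0_itv : a <= x0 <= b.
Hypothesis x0_bad : u x0 < N%:R - 1 - `|x0|.

Let d0 : 0 < delta. Proof. by case/andP: delta_bounds. Qed.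
Let d1 : delta < 2^-1. Proof. by case/andP: delta_bounds. Qed.
Let N1 : 1 <= N%:R :> R. Proof. by rewrite ler1n. Qed.

(** Obstacles are centred at half-integer heights and have radius below [1/2], so the integer part
    of the height identifies the only obstacle that can be met. *)
Let phi_box (x s : R) (k : int * int) :
  phi (x - (bpt R k).1) (s - (bpt R k).2) != 0 ->
  [/\ k.1%:~R - delta <= x <= k.1%:~R + delta & Num.floor s = k.2].
Proof.
move=> /phi_supp; rewrite /bpt /= !ler_norml => -[/andP[x1 x2] /andP[s1 s2]].
split; first by apply/andP; split; lra.
by apply: floor_def; have := d1; rewrite intrD => ?; apply/andP; split; lra.
Qed.

Let a_node0 : a < node N 0. Proof. by have := d1; rewrite node0; lra. Qed.
Let node0_b : node N 0 < b. Proof. by have := d1; have := N1; rewrite node0; lra. Qed.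
Let nodeL_b : node N L < b. Proof. by have := d1; rewrite node_last//; lra. Qed.
Let a_nodeL : a < node N L. Proof. by have := d1; have := N1; rewrite node_last//; lra. Qed.

Let u_drv x : a < x < b -> is_derive x 1 u (derive1 u x).
Proof.
move=> xab; have [_ [H _]] := u_sol; have [du _] := H x xab.
by apply: DeriveDef; [exact: du|rewrite derive1E].
Qed.

Let v_drv x : a < x < b -> is_derive x 1 (derive1 u) (- (f x (u x) + F)).
Proof.
move=> xab; have [_ [H _]] := u_sol; have [_ [dv E]] := H x xab.
apply: DeriveDef; first exact: dv.
by rewrite -derive1E; move: E; lra.
Qed.

(* Near the two ends of the interval there is no obstacle, so the solution is
   concave there. *)
Let no_obstacle x s : a < x < b -> (x <= node N 0) || (node N L <= x) ->
  0 <= f x s.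
Proof.
move=> /andP[ax xb] xe; rewrite /rfield fsbig1 ?subr0// => k _.
have [->|] := eqVneq (phi (x - (bpt R k).1) (s - (bpt R k).2)) 0; first by rewrite mulr0.
move=> /phi_box[/andP[x1 x2] _]; exfalso.
have h1 := d0; have h2 := d1.
case/orP: xe => [xn|xn].
  have k1 : (- N%:Z)%:~R < (k.1%:~R : R) by rewrite intrN; lra.
  have k2 : k.1%:~R < (1 - N%:Z)%:~R :> R by rewrite intrB; move: xn; rewrite node0; lra.
  by rewrite !ltr_int in k1 k2; clear -k1 k2; lia.
have k1 : k.1%:~R < (N%:Z)%:~R :> R by lra.
have k2 : (N%:Z - 1)%:~R < k.1%:~R :> R.
  by rewrite intrB; move: xn; rewrite node_last//; lra.
by rewrite !ltr_int in k1 k2; clear -k1 k2; lia.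
Qed.

(** On the obstacle-free stretch the solution is concave and starts from zero, so its final slope is
    at most its mean slope [u (node N 0) / kappa]. *)
Let left_end : kappa * derive1 u (node N 0) <= u (node N 0).
Proof.
have [cu [_ [ua _]]] := u_sol.
have [||c] := @MVT R u (derive1 u) a (node N 0) a_node0.
- move=> x; rewrite in_itv/= => /andP[ax xn]; apply: u_drv.
  by rewrite ax (lt_trans xn).
- by apply: continuous_subspaceW cu; apply: subset_itvl; rewrite bnd_simp ltW.
rewrite in_itv/= => /andP[ac cn] E.
have kE : node N 0 - a = kappa by rewrite node0; lra.
rewrite ua subr0 kE in E; rewrite E mulrC ler_wpM2r//; first by have := d1; lra.
rewrite -lerN2.
apply: (@is_derive_ge0_le R (fun x => - derive1 u x) (fun x => f x (u x) + F) _ _ (ltW cn)).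
  move=> x /andP[cx xn]; have xab : a < x < b.
    by rewrite (lt_le_trans ac)//= (le_lt_trans xn).
  by have dv := v_drv xab; apply: is_derive_eq; rewrite opprK.
move=> x /andP[cx xn]; rewrite addr_ge0// no_obstacle ?xn//.
by rewrite (lt_le_trans ac)//= (le_lt_trans xn).
Qed.

Let right_end : 0 <= kappa * derive1 u (node N L) + u (node N L).
Proof.
have [cu [_ [_ ub]]] := u_sol.
have [||c] := @MVT R u (derive1 u) (node N L) b nodeL_b.
- move=> x; rewrite in_itv/= => /andP[nx xb]; apply: u_drv.
  by rewrite xb andbT (lt_trans _ nx).
- by apply: continuous_subspaceW cu; apply: subset_itvr; rewrite bnd_simp ltW.
rewrite in_itv/= => /andP[nc cb] E.
have kE : b - node N L = kappa by rewrite node_last//; lra.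
rewrite ub sub0r kE in E.
suff : derive1 u c * kappa <= derive1 u (node N L) * kappa by lra.
rewrite ler_wpM2r//; first by have := d1; lra.
rewrite -lerN2.
apply: (@is_derive_ge0_le R (fun x => - derive1 u x) (fun x => f x (u x) + F) _ _ (ltW nc)).
  move=> x /andP[nx xc]; have xab : a < x < b.
    by rewrite (lt_le_trans _ nx)//= (le_lt_trans xc).
  by have dv := v_drv xab; apply: is_derive_eq; rewrite opprK.
move=> x /andP[nx xc]; rewrite addr_ge0// no_obstacle ?nx ?orbT//.
by rewrite (lt_le_trans _ nx)//= (le_lt_trans xc).
Qed.

(* The obstacles met in the cell between [node N n] and [node N n.+1] sit at
   abscissa [column n], the midpoint of the cell. *)
Definition column (n : nat) : int := n%:Z + (1 - N%:Z).

Lemma bad_solution_path (th : R) : 0 < th -> th <= 1 ->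
  exists (h s : nat -> int) (V : nat -> nat),
  [/\ 0 <= h 0%N,
      forall n, (n < L)%N -> (`|s n.+1 - s n| <= V n + 2)%N /\
                             (`|(h n.+1 - (h n + s n))%R| <= V n + 2)%N &
      1 <= expR (5 * N%:R) * expR (- (th * kappa * F / 16 * N%:R)) *
           expR (- (th * kappa / 80 / N%:R * `|s 0%N|%N%:R)) *
           expR (- (th * kappa / 80 / N%:R ^+ 2 * `|h 0%N|%N%:R)) *
           \prod_(n < L) cell_factor (th / 2 * weight kappa N n)
             (fun m => 2 * th * (Phi * Num.max (lw (column n, m)) 0)) (h n) (s n) (V n)].
Proof.
move=> th0 th1.
have h0 := d0; have h1 := d1; have n1 := N1.
have [cu [_ [ua ub]]] := u_sol.
have Phi0 : 0 <= Phi by apply: le_trans (phi_le 0 0).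
pose a' := a + kappa / 2; pose b' := b - kappa / 2.
have aa' : a < a' by rewrite /a'; lra.
have bb' : b' < b by rewrite /b'; lra.
have a'n : a' < node N 0 by rewrite node0 /a'; lra.
have nb' : node N L < b' by rewrite node_last// /b'; lra.
have a'b' : a' <= b' by rewrite /a' /b'; lra.
(* Clamping the abscissa to a slightly smaller interval extends [u] to a continuous function on the
   whole line without changing it near the nodes. *)
pose cl (x : R) := Num.max a' (Num.min x b').
have ccl : continuous cl.
  move=> x; apply: (@continuous_max R R (fun=> a') (fun x => Num.min x b')).
    exact: cst_continuous.
  apply: (@continuous_min R R id (fun=> b')); last exact: cst_continuous.
  exact: cvg_id.
have clab x : a < cl x < b.
  rewrite /cl lt_max aa'/= gt_max (le_lt_trans a'b')//= gt_min bb' orbT//.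
have clE x : a' <= x <= b' -> cl x = x.
  by move=> /andP[ax xb]; rewrite /cl min_l// max_r.
pose U x := u (cl x).
have cU : continuous U.
  move=> x; apply: continuous_comp; first exact: ccl.
  apply: differentiable_continuous; apply/derivable1_diffP.
  by case: (u_drv (clab x)).
have insideab x : node N 0 <= x <= node N L -> a' < x < b'.
  by move=> /andP[x1 x2]; rewrite (lt_le_trans a'n)//= (le_lt_trans x2).
have UE x : a' < x < b' -> U x = u x.
  by move=> /andP[x1 x2]; rewrite /U clE// !ltW.
have abW x : a' < x < b' -> a < x < b.
  by move=> /andP[x1 x2]; rewrite (lt_trans aa')//= (lt_trans x2).
have U0 x : 0 <= U x.
  by apply: u_nonneg; have /andP[? ?] := clab x; rewrite !ltW.
(* A bound on [u] confines the path to a finite box of lattice indices, over which the field is an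
   ordinary finite sum. *)
have [c _ cmax] := @EVT_max R u a b (ltW (lt_trans aa' (le_lt_trans a'b' bb'))) cu.
pose K := (N + (Num.truncn (u c)).+2)%N.
have UB x : U x < (Num.truncn (u c)).+1%:R.
  apply: le_lt_trans (truncnS_gt (u c)); apply: cmax.
  by rewrite in_itv/=; have /andP[? ?] := clab x; rewrite !ltW.
pose ks := lattice_box K.
have ksP x k : a < x < b -> phi (x - (bpt R k).1) (U x - (bpt R k).2) != 0 -> k \in ks.
  move=> /andP[ax xb] /phi_box[/andP[x1 x2] fl]; apply: mem_lattice_box.
    have k1 : k.1%:~R < (N%:Z + 1)%:~R :> R by rewrite intrD; lra.
    have k2 : (- N%:Z - 1)%:~R < k.1%:~R :> R by rewrite intrB intrN; lra.
    by rewrite !ltr_int in k1 k2; rewrite /K; clear -k1 k2; lia.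
  have k1 : 0 <= k.2 by rewrite -fl floor_ge_int.
  have k2 : k.2 < (Num.truncn (u c)).+1%:Z by rewrite -fl floor_lt_int.
  by rewrite /K; clear -k1 k2; lia.
pose bump k x := phi (x - (bpt R k).1) (U x - (bpt R k).2).
have cbump k : continuous (bump k).
  apply: (@continuous_uncurried R phi (fun x => x - (bpt R k).1) (fun x => U x - (bpt R k).2)) => //.
    by move=> x; apply: cvgB; [exact: cvg_id|exact: cvg_cst].
  by move=> x; apply: cvgB; [exact: cU|exact: cvg_cst].
(* Only the positive parts of the strengths count as obstacles; the negative parts join the driving
   term [G]. The splitting thus holds at every sample point, although the strengths are positive
   only almost surely. *)
pose H x := \sum_(k <- ks) Num.max (lw k) 0 * bump k x.
pose G x := F + (g x (U x) + \sum_(k <- ks) (Num.max (lw k) 0 - lw k) * bump k x).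
have cH : continuous H.
  apply: continuous_sumr => k x; apply: cvgM; [exact: cvg_cst|exact: cbump].
have cG : continuous G.
  move=> x; apply: cvgD; first exact: cvg_cst.
  apply: cvgD; first exact: (@continuous_uncurried R g (fun x => x) U g_cont (fun x => @cvg_id _ _) cU).
  by move: x; apply: continuous_sumr => k x; apply: cvgM; [exact: cvg_cst|exact: cbump].
have H0 x : 0 <= H x.
  apply: sumr_ge0 => k _; apply: mulr_ge0; last exact: phi_ge0.
  by rewrite le_max lexx orbT.
have GF x : F <= G x.
  rewrite /G lerDl addr_ge0// sumr_ge0// => k _; apply: mulr_ge0; last exact: phi_ge0.
  by rewrite subr_ge0 le_max lexx.
have fE x : a < x < b -> f x (U x) = g x (U x) - \sum_(k <- ks) lw k * bump k x.
  move=> xab; rewrite /rfield; congr (_ - _).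
  rewrite -(fsbig_widen [set` ks] setT)//; last first.
    move=> k [_ /= kks]; have [b0|b0] := eqVneq (bump k x) 0.
      by rewrite -/(bump k x) b0 mulr0.
    by case: kks; exact: ksP b0.
  by rewrite -fsbig_seq// lattice_box_uniq.
have insideU x : node N 0 <= x <= node N L -> is_derive x 1 U (derive1 u x).
  move=> /insideab xi; apply: near_eq_is_derive (u_drv (abW x xi)).
  have : \forall t \near x, t \in `]a', b'[%R by apply: near_in_itvoo; rewrite in_itv.
  by apply: filterS => t; rewrite in_itv/= => ti; rewrite UE.
have insideV x : node N 0 <= x <= node N L ->
    is_derive x 1 (derive1 u) (H x - G x).
  move=> /insideab xi; have := v_drv (abW x xi).
  rewrite -UE// fE; last exact: abW.
  congr (is_derive _ _ _ _); rewrite /H /G.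
  rewrite (_ : \sum_(k <- ks) (Num.max (lw k) 0 - lw k) * bump k x =
     \sum_(k <- ks) Num.max (lw k) 0 * bump k x - \sum_(k <- ks) lw k * bump k x); last first.
    by rewrite -sumrB; apply: eq_bigr => k _; rewrite mulrBl.
  by ring.
have H_le n x : (n < L)%N -> node N n <= x <= node N n.+1 ->
    H x <= Phi * Num.max (lw (column n, Num.floor (U x))) 0.
  move=> nL /andP[nx xn].
  have xi : a < x < b.
    apply/abW/insideab; rewrite (le_trans _ nx) ?node_le//=.
    by rewrite (le_trans xn) ?node_le.
  have kE k : bump k x != 0 -> k = (column n, Num.floor (U x)).
    move=> /phi_box[/andP[x1 x2] fl]; rewrite fl [LHS]surjective_pairing; congr (_, _).
    move: nx xn; rewrite /node /column => nx xn.
    have k1 : k.1%:~R < (n%:Z + (1 - N%:Z) + 1)%:~R :> R.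
      by rewrite !intrD intrN; move: xn; rewrite -natr1; lra.
    have k2 : (n%:Z + (1 - N%:Z) - 1)%:~R < k.1%:~R :> R.
      by rewrite intrB !intrD intrN; lra.
    by rewrite !ltr_int in k1 k2; clear -k1 k2; lia.
  have M0 : 0 <= Num.max (lw (column n, Num.floor (U x))) 0 by rewrite le_max lexx orbT.
  rewrite /H (bigID (fun k => k == (column n, Num.floor (U x)))) /= addrC big1 ?add0r.
    rewrite -big_filter; set r := [seq _ <- _ | _].
    have ur : uniq r by rewrite filter_uniq// lattice_box_uniq.
    have : (size r <= 1)%N.
      apply: (@uniq_leq_size _ r [:: (column n, Num.floor (U x))]) => // k.
      by rewrite mem_filter inE => /andP[].
    case E : r => [|k [|]]// _; first by rewrite big_nil mulr_ge0.
    have : k \in r by rewrite E inE.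
    rewrite mem_filter => /andP[/eqP -> _].
    by rewrite big_seq1 mulrC ler_wpM2r// phi_le.
  move=> k kne; have [->|/kE kk] := eqVneq (bump k x) 0; first by rewrite mulr0.
  by rewrite kk eqxx in kne.
have x0N : `|x0| < N%:R - 1.
  by have := u_nonneg x0_itv; have := x0_bad; lra.
have x0i : a' < x0 < b'.
  move: x0N; rewrite ltr_norml => /andP[? ?].
  by rewrite /a' /b'; apply/andP; split; lra.
have x0_ge : - `|x0| <= x0 by rewrite lerNl -normrN ler_norm.
have ux0 : U x0 < N%:R - 1 - `|x0| by rewrite UE.
have U00 : U (node N 0) = u (node N 0).
  by rewrite UE// insideab// lexx node_le.
have UL0 : U (node N L) = u (node N L).
  by rewrite UE// insideab// lexx node_le.
have k0 : 0 < kappa by lra.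
have k1 : kappa <= 2^-1 by lra.
have le0 : kappa * derive1 u (node N 0) <= U (node N 0) by rewrite U00.
have re0 : 0 <= kappa * derive1 u (node N L) + U (node N L) by rewrite UL0.
exact: (@discretized_path R N kappa F th U (derive1 u) H G x0 `|x0|
  (fun n m => Phi * Num.max (lw (column n, m)) 0) N_gt0 k0 k1 F_ge0 th0 th1
  cU cH cG H0 GF insideU insideV (fun x _ => U0 x) le0 re0 (ler_norm x0) x0_ge x0N ux0 H_le).
Qed.

End bad_solution.

(** * Exponential bound *)

Section union_bound.
Context {R : realType} {d : measure_display} {T : measurableType d}.
Variables (P : probability T R) (l : int * int -> T -> R) (lam : R).
Hypothesis lam_gt0 : 0 < lam.
Hypothesis l_meas : forall k, measurable_fun setT (l k).
Hypothesis l_indep : mutually_independent P l.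
Hypothesis l_tail : forall k (r : R), 0 <= r ->
  P [set w | r < l k w] = (expR (- (lam * r)))%:E.

Lemma ler_sum_term (I : finType) (F : I -> R) (i : I) :
  (forall j, 0 <= F j) -> F i <= \sum_j F j.
Proof. by move=> F0; rewrite (bigD1 i)//= lerDl sumr_ge0. Qed.

Lemma layers_nonneg M (x : R) : 0 <= layers lam M x.
Proof.
apply: mulr_ge0 (expR_ge0 _) _; apply: addr_ge0 => //.
by apply: sumr_ge0 => i _; rewrite mulr_ge0 ?expR_ge0.
Qed.

Lemma cell_prefactor_ge0 (r v S : R) : 0 <= v -> 0 <= S ->
  0 <= expR r * (8 * (1 + v) / (1 + S)).
Proof.
move=> v0 S0; apply: mulr_ge0; first exact: expR_ge0.
by rewrite divr_ge0 ?mulr_ge0 ?addr_ge0.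
Qed.

Lemma path_sum_ge0 M (rt : nat -> R) col k n h s w : 0 <= path_sum l lam M rt col k n h s w.
Proof.
elim: k => [//|k IH] in n h s *; rewrite /=.
apply: sumr_ge0 => V _; apply: sumr_ge0 => p _; apply: sumr_ge0 => q _.
apply: mulr_ge0; first exact: cell_prefactor_ge0.
by apply: sumr_ge0 => t _; rewrite mulr_ge0 ?layers_nonneg.
Qed.

(** All terms of the sum are nonnegative, so it dominates the one that follows the given path;
    [layers_ge] replaces the exponentials there, provided [M] exceeds every [V] and bounds every
    strength involved. *)
Lemma path_sum_ge M (rt : nat -> R) (col : nat -> int) (h s : nat -> int)
    (V : nat -> nat) w k n :
  (forall j, (j < k)%N -> (V (n + j)%N < M)%N) ->
  (forall j, (j < k)%N -> (`|s (n + j).+1 - s (n + j)| <= V (n + j) + 2)%N /\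
     (`|(h (n + j).+1 - (h (n + j)%N + s (n + j)%N))%R| <= V (n + j) + 2)%N) ->
  (forall j t, (j < k)%N -> (t < 2 * `|s (n + j)%N|%N + 2 * V (n + j) + 5)%N ->
     Num.max (l (col (n + j)%N,
        h (n + j)%N - (`|s (n + j)%N|%N + V (n + j) + 2)%N%:Z + t%:Z) w) 0 <= M%:R) ->
  \prod_(j < k) cell_factor (rt (n + j)%N)
     (fun m => lam / 2 * Num.max (l (col (n + j)%N, m) w) 0)
     (h (n + j)%N) (s (n + j)%N) (V (n + j)%N) <=
  path_sum l lam M rt col k n (h n) (s n) w.
Proof.
elim: k n => [|k IH] n HV Hhs Hl; first by rewrite big_ord0.
rewrite big_ord_recl /= addn0.
have V0 := HV 0%N (ltn0Sn k); have [s0 h0] := Hhs 0%N (ltn0Sn k).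
have l0 t := Hl 0%N t (ltn0Sn k).
rewrite !addn0 in V0 s0 h0 l0.
have {}IH : \prod_(j < k) cell_factor (rt (n.+1 + j)%N)
     (fun m => lam / 2 * Num.max (l (col (n.+1 + j)%N, m) w) 0)
     (h (n.+1 + j)%N) (s (n.+1 + j)%N) (V (n.+1 + j)%N) <=
    path_sum l lam M rt col k n.+1 (h n.+1) (s n.+1) w.
  apply: IH => [j jk|j jk|j t jk]; rewrite addSnnS;
    [exact: HV|exact: Hhs|exact: Hl].
set PP := \prod_(j < k) _ in IH.
rewrite [X in _ * X](_ : _ = PP); last first.
  by apply: eq_bigr => i _; rewrite /bump leq0n add1n addSnnS.
move=> {HV Hhs Hl}.
have PP0 : 0 <= PP.
  apply: prodr_ge0 => i _; apply: mulr_ge0; first exact: cell_prefactor_ge0.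
  by apply: sumr_ge0 => t _; exact: expR_ge0.
have [p pV pE] : exists2 p : nat, (p < 2 * V n + 5)%N &
    h n + s n + (p%:Z - (V n + 2)%N%:Z) = h n.+1.
  by exists `|(h n.+1 - (h n + s n) + (V n + 2)%N%:Z)%R|%N; clear -h0; lia.
have [q qV qE] : exists2 q : nat, (q < 2 * V n + 5)%N &
    s n + (q%:Z - (V n + 2)%N%:Z) = s n.+1.
  by exists `|(s n.+1 - s n + (V n + 2)%N%:Z)%R|%N; clear -s0; lia.
pose term (v p q : nat) :=
  (expR (- (rt n * v%:R)) * (8 * (1 + v%:R) / (1 + `|s n|%N%:R))) *
      \sum_(t < 2 * `|s n|%N + 2 * v + 5)
         layers lam M (l (col n, h n - (`|s n|%N + v + 2)%N%:Z + t%:Z) w) *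
         path_sum l lam M rt col k n.+1 (h n + s n + (p%:Z - (v + 2)%N%:Z))
           (s n + (q%:Z - (v + 2)%N%:Z)) w.
have term0 v p' q' : 0 <= term v p' q'.
  apply: mulr_ge0; first exact: cell_prefactor_ge0.
  by apply: sumr_ge0 => t _; rewrite mulr_ge0 ?layers_nonneg ?path_sum_ge0.
apply: (@le_trans _ _ (term (V n) p q)).
  rewrite /cell_factor /term pE qE -mulrA; apply: ler_wpM2l; first exact: cell_prefactor_ge0.
  rewrite mulr_suml; apply: ler_sum => t _; apply: ler_pM => //.
  by apply: layers_ge; [exact: ltW|exact: l0].
apply: (le_trans _ (@ler_sum_term _ (fun v : 'I_M => \sum_(p < 2 * v + 5)
    \sum_(q < 2 * v + 5) term v p q) (Ordinal V0) _)); last first.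
  by move=> v; apply: sumr_ge0 => p' _; exact: sumr_ge0.
apply: (le_trans _ (@ler_sum_term _ (fun p : 'I_(2 * V n + 5) =>
    \sum_(q < 2 * V n + 5) term (V n) p q) (Ordinal pV) _)); last first.
  by move=> p'; exact: sumr_ge0.
exact: (@ler_sum_term _ (fun q : 'I_(2 * V n + 5) => term (V n) p q) (Ordinal qV)).
Qed.

(** Markov's inequality at level one, the cylinder over the empty list being the whole space. *)
Lemma dominated_markov c X a : dominated P l c X a ->
  measurable [set w | 1 <= X w] /\ (P [set w | (1 <= X w)%R] <= a%:E)%E.
Proof.
move=> [mX X0 a0 H].
have mE : measurable [set w | 1 <= X w].
  rewrite (_ : [set _ | _] = setT `&` X @^-1` `[1, +oo[); first exact: mX.
  by rewrite setTI; apply/seteqP; split => w /=; rewrite in_itv/= andbT.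
split => //.
have cylT : cylinder l [::] (fun=> setT) = setT by apply/seteqP; split.
have := H [::] (fun=> setT) isT (fun=> measurableT) (fun i (iN : i \in [::]) => False_ind _ (notF iN)).
rewrite cylT probability_setT mule1; apply: le_trans.
rewrite -[X in P X]setIT -integral_indic//.
apply: ge0_le_integral => //.
- by apply/measurable_EFinP; exact: measurable_indic.
- exact/measurable_EFinP.
move=> w _; rewrite lee_fin indicE.
by case: (boolP (w \in _)) => [|_]; [rewrite inE|exact: X0].
Qed.

Definition decay (kappa th F : R) (N : nat) : R :=
  expR (5 * N%:R) * expR (- (th * kappa * F / 16 * N%:R)).

(** The sum over initial states of the right-hand side of [bad_solution_path]: for [M] large it is
    at least [1] wherever the solution is too low. The boolean is the sign of the initial slope;
    counting slope zero twice is harmless. *)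
Definition total_path_sum (kappa th F : R) (N M : nat) (w : T) : R :=
  decay kappa th F N *
  \sum_(h0 < M) expR (- (th * kappa / 80 / N%:R ^+ 2 * h0%:R)) *
   (\sum_(v < M) expR (- (th * kappa / 80 / N%:R * v%:R)) *
     (\sum_(sg : bool) path_sum l lam M (fun n => th / 2 * weight kappa N n)
        (column N) (2 * N).-1 0 h0%:Z (if sg then - v%:Z else v%:Z) w)).

(** The cost of a cell whose weight equals [kappa]; it does not depend on [F]. *)
Definition path_const (kappa th : R) : R :=
  1000 * (expR (lam / 2) * (2 + 2 / lam)) * (1152 * expR 1 * (2 / th) ^+ 5) / kappa ^+ 5.

(** Each factor is [path_const] times the fifth power of [kappa / weight]. By [prod_weight_ge] these
    ratios multiply to at most [e^(4N)], hence the [20]. *)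
Lemma prod_cell_bound (kappa th : R) (N : nat) : 0 < kappa -> 0 < th -> (0 < N)%N ->
  \prod_(n < (2 * N).-1) (1000 * (expR (lam / 2) * (2 + 2 / lam)) *
     (1152 * expR 1 / (th / 2 * weight kappa N n) ^+ 5)) <=
  expR ((2 * path_const kappa th + 20) * N%:R).
Proof.
move=> k0 th0 N0; set L := (2 * N).-1; set Q := path_const kappa th.
have lam0 := lam_gt0.
have Q0 : 0 <= Q.
  apply: divr_ge0; last exact/exprn_ge0/ltW.
  have th2 : 0 <= 2 / th by rewrite divr_ge0// ltW.
  have c1 : 0 <= expR (lam / 2) * (2 + 2 / lam).
    by rewrite mulr_ge0 ?expR_ge0// addr_ge0// divr_ge0// ltW.
  exact: (mulr_ge0 (mulr_ge0 (ler0n R 1000) c1)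
    (mulr_ge0 (mulr_ge0 (ler0n R 1152) (expR_ge0 1)) (exprn_ge0 5 th2))).
have -> : \prod_(n < L) (1000 * (expR (lam / 2) * (2 + 2 / lam)) *
     (1152 * expR 1 / (th / 2 * weight kappa N n) ^+ 5)) =
   Q ^+ L * (kappa ^+ L / \prod_(n < L) weight kappa N n) ^+ 5.
  transitivity (\prod_(n < L) (Q * (kappa / weight kappa N n) ^+ 5)).
    apply: eq_bigr => n _; have w0 := weight_gt0 k0 (ltn_ord n).
    by rewrite /Q /path_const; field; rewrite !gt_eqF.
  rewrite big_split /= prodr_const card_ord; congr (_ * _).
  by rewrite prodrXl prodf_div prodr_const card_ord.
have W : kappa ^+ L / \prod_(n < L) weight kappa N n <= expR (4 * N%:R).
  rewrite ler_pdivrMr; last by apply: prodr_gt0 => n _; exact: weight_gt0.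
  rewrite mulrC -ler_pdivrMr ?expR_gt0// -expRN.
  exact: prod_weight_ge.
rewrite mulrDl expRD; apply: ler_pM; rewrite ?exprn_ge0//.
- rewrite divr_ge0 ?exprn_ge0 ?(ltW k0)//; apply: prodr_ge0 => n _.
  exact/ltW/weight_gt0.
- apply: (@le_trans _ _ (expR Q ^+ L)).
    rewrite lerXn2r ?nnegrE ?expR_ge0//.
    by apply: le_trans (expR_ge1Dx Q); rewrite lerDr.
  rewrite -expRM_natl ler_expR (natr_double_pred N0).
  by move: Q0; lra.
- rewrite (_ : 20 * N%:R = 5%:R * (4 * N%:R)); last by ring.
  rewrite expRM_natl lerXn2r ?nnegrE ?expR_ge0// divr_ge0 ?exprn_ge0 ?(ltW k0)//.
  by apply: prodr_ge0 => n _; exact/ltW/weight_gt0.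
Qed.

(** The sums over the initial slope and height cost only powers of [N] and constants, bounded by
    exponentials in [N]. The driving force enters the exponent solely through
    [- th * kappa * F / 16], so it wins for large [F]. *)
Lemma total_path_sum_bound (kappa th F : R) (N M : nat) :
  0 < kappa -> kappa <= 1 -> 0 < th -> th <= 1 -> (0 < N)%N ->
  dominated P l (column N 0) (total_path_sum kappa th F N M)
    (expR ((30 + 160 / (th * kappa) + 2 * path_const kappa th - th * kappa * F / 16) * N%:R)).
Proof.
move=> k0 k1 th0 th1 N0; have lam0 := lam_gt0.
have n1 : 1 <= N%:R :> R by rewrite ler1n.
have n0 : 0 < N%:R :> R by rewrite ltr0n.
have tk0 : 0 < th * kappa by rewrite mulr_gt0.
set L := (2 * N).-1.
pose c1 := expR (lam / 2) * (2 + 2 / lam).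
have c1M : expR (lam / 2) * (1 + \sum_(m < M) expR (- (lam / 2 * m%:R))) <= c1.
  apply: ler_wpM2l; first exact: expR_ge0.
  have := @sum_expRN_le R (lam / 2) M; rewrite divr_gt0// invf_div => /(_ isT).
  by lra.
have c10 : 0 <= c1.
  by rewrite mulr_ge0 ?expR_ge0// addr_ge0// divr_ge0// ltW.
pose S n : R := \sum_(V < M) (1 + V%:R) ^+ 4 * expR (- (th / 2 * weight kappa N n * V%:R)).
pose A n := if (n < L)%N then
    1000 * c1 * (1152 * expR 1 / (th / 2 * weight kappa N n) ^+ 5)
  else 1000 * c1 * S n.
have HA n : 1000 * c1 * S n <= A n.
  rewrite /A; case: ifPn => nL; last exact: lexx.
  apply: ler_wpM2l; first exact: (mulr_ge0 (ler0n R 1000) c10).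
  have w0 := weight_gt0 k0 nL.
  have w1 : weight kappa N n <= 1 by apply: weight_le1; rewrite ?(ltW k0).
  have h0 : 0 < th / 2 by rewrite divr_gt0.
  have h1 : th / 2 <= 1 by rewrite ler_pdivrMr// (le_trans th1)// mul1r ler1n.
  apply: sum_poly_expRN_le; apply/andP; split; first exact: mulr_gt0.
  exact: (mulr_ile1 (ltW h0) (ltW w0) h1 w1).
have colS k : column N k.+1 = column N k + 1.
  by rewrite /column -addn1 PoszD addrAC.
have D h s := dominated_path_sum l_meas l_indep l_tail (ltW lam0) c1M colS HA L 0 h s.
pose B := \prod_(j < L) A (0 + j)%N.
have B0 : 0 <= B by case: (D 0 0).
have BE : B <= expR ((2 * path_const kappa th + 20) * N%:R).
  apply: le_trans (prod_cell_bound k0 th0 N0); rewrite le_eqVlt; apply/orP; left.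
  by apply/eqP; apply: eq_bigr => n _; rewrite /A add0n ltn_ord.
pose e2 (x : nat) := expR (- (th * kappa / 80 / N%:R ^+ 2 * x%:R)) : R.
pose e1 (x : nat) := expR (- (th * kappa / 80 / N%:R * x%:R)) : R.
apply: (@dominated_le _ _ _ P l _ _ (decay kappa th F N *
   \sum_(h0 < M) e2 h0 * (\sum_(v < M) e1 v * (\sum_(sg : bool) B)))); last first.
  apply: (dominatedZ l_meas); first exact: (mulr_ge0 (expR_ge0 _) (expR_ge0 _)).
  apply: (dominated_sum l_meas) => h0; apply: (dominatedZ l_meas); first exact: expR_ge0.
  apply: (dominated_sum l_meas) => v; apply: (dominatedZ l_meas); first exact: expR_ge0.
  by apply: (dominated_sum l_meas) => sg; exact: D.
rewrite big_bool /= -mulr_suml -mulr_suml /decay.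
pose ep := th * kappa / 80.
have ep0 : 0 < ep by rewrite divr_gt0.
have E (x : R) : 1 + x <= expR x := expR_ge1Dx x.
have nE : N%:R <= expR N%:R :> R by apply: le_trans (E _); rewrite lerDr.
have epE : 1 + ep^-1 <= expR (ep^-1 * N%:R).
  apply: (le_trans (E _)); rewrite ler_expR ler_peMr// invr_ge0 ltW//.
have S1 : \sum_(v < M) e1 v <= expR (ep^-1 * N%:R) * expR N%:R.
  have := @sum_expRN_le R (ep / N%:R) M; rewrite divr_gt0// invf_div => /(_ isT) H.
  apply: (le_trans H); apply: (@le_trans _ _ ((1 + ep^-1) * N%:R)).
    by rewrite mulrDl mul1r [ep^-1 * _]mulrC lerD2r.
  by apply: ler_pM => //; rewrite ?addr_ge0// ?invr_ge0 ltW.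
have S2 : \sum_(v < M) e2 v <= expR (ep^-1 * N%:R) * (expR N%:R * expR N%:R).
  have := @sum_expRN_le R (ep / N%:R ^+ 2) M.
  rewrite divr_gt0 ?exprn_gt0// invf_div => /(_ isT) H.
  apply: (le_trans H); apply: (@le_trans _ _ ((1 + ep^-1) * (N%:R * N%:R))).
    rewrite mulrDl mul1r [ep^-1 * _]mulrC -expr2 lerD2r.
    by rewrite exprn_ege1.
  apply: ler_pM => //; rewrite ?addr_ge0// ?invr_ge0 ?(ltW ep0)// ?mulr_ge0//.
  by apply: ler_pM.
have BB : B + B <= expR N%:R * expR ((2 * path_const kappa th + 20) * N%:R).
  have -> : B + B = 2 * B by ring.
  by apply: ler_pM => //; apply: le_trans (E _); rewrite lerD2l.
have e10 : 0 <= \sum_(v < M) e1 v by apply: sumr_ge0 => v _; exact: expR_ge0.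
have e20 : 0 <= \sum_(v < M) e2 v by apply: sumr_ge0 => v _; exact: expR_ge0.
apply: (@le_trans _ _ (expR (5 * N%:R) * expR (- (th * kappa * F / 16 * N%:R)) *
  (expR (ep^-1 * N%:R) * (expR N%:R * expR N%:R) *
   (expR (ep^-1 * N%:R) * expR N%:R *
    (expR N%:R * expR ((2 * path_const kappa th + 20) * N%:R)))))).
  apply: ler_wpM2l; first by rewrite mulr_ge0 ?expR_ge0.
  apply: ler_pM => //; first by rewrite mulr_ge0// addr_ge0.
  by apply: ler_pM => //; rewrite addr_ge0.
rewrite -!expRD ler_expR.
have -> : ep^-1 = 80 / (th * kappa) by rewrite /ep invf_div.
have -> : 160 / (th * kappa) = 2 * (80 / (th * kappa)) by rewrite mulrA -natrM.
move: (80 / (th * kappa)) (path_const kappa th) => y z.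
rewrite -subr_ge0 (_ : _ - _ = N%:R); last by ring.
exact: ltW.
Qed.

End union_bound.

(** * Removal of the truncation and measurability of the good event *)

Section events.
Context {R : realType} {d : measure_display} {T : measurableType d}.
Variable P : probability T R.

(** The tail intersections increase with [m] and each lies in [E m], so continuity from below passes
    the bound to the limit inferior. This is needed because the truncation level capturing a path
    depends on the sample point. *)
Lemma measure_liminf_le (E : nat -> set T) (c : R) :
  (forall M, measurable (E M)) -> (forall M, (P (E M) <= c%:E)%E) ->
  measurable (\bigcup_m \bigcap_(M in [set M | (m <= M)%N]) E M) /\
  (P (\bigcup_m \bigcap_(M in [set M | (m <= M)%N]) E M) <= c%:E)%E.
Proof.
move=> mE PE; pose A m := \bigcap_(M in [set M | (m <= M)%N]) E M.
have mA m : measurable (A m) by apply: bigcap_measurableType => M _.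
have mU : measurable (\bigcup_m A m) by exact: bigcupT_measurable.
split => //.
have ndA : nondecreasing_seq A.
  move=> m m' mm'; apply/subsetPset => w Am M /= m'M; apply: Am.
  exact: leq_trans m'M.
have cvgA := @nondecreasing_cvg_mu _ T R P A mA mU ndA.
rewrite -(cvg_lim _ cvgA)//; apply: lime_le; first by apply/cvg_ex; eexists; exact: cvgA.
apply: nearW => m; apply: le_trans (PE m); apply: le_measure; rewrite ?inE //.
by move=> w; apply; rewrite /= leqnn.
Qed.

(** By continuity in the open interval it suffices to test rational points; the endpoints, where
    continuity is not assumed, are covered by the last hypothesis. *)
Lemma measurable_dominates (u : T -> R -> R) (psi : R -> R) (a b : R) :
  (forall x, measurable_fun setT (fun w => u w x)) ->
  continuous psi -> (forall w x, a < x < b -> {for x, continuous (u w)}) ->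
  (forall w x, a <= x <= b -> ~~ (a < x < b) -> psi x <= u w x) ->
  measurable [set w | forall x, a <= x <= b -> psi x <= u w x].
Proof.
move=> mu cpsi cu ends.
pose A (q : rat) : set T :=
  if a <= ratr q <= b then [set w | psi (ratr q) <= u w (ratr q)] else setT.
have mA q : measurable (A q).
  rewrite /A; case: ifP => // _.
  rewrite (_ : [set _ | _] = setT `&` (fun w => u w (ratr q)) @^-1` `[psi (ratr q), +oo[).
    exact: mu.
  by rewrite setTI; apply/seteqP; split => w /=; rewrite in_itv/= andbT.
rewrite (_ : [set _ | _] = ~` (\bigcup_q (~` A q))); last first.
  rewrite setC_bigcup; under eq_bigcapr do rewrite setCK.
  apply/seteqP; split => [w Hw q _|w Hw x xab].
    by rewrite /A; case: ifP => //= qab; exact: Hw.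
  have [xoo|xoo] := boolP (a < x < b); last exact: ends.
  rewrite leNgt; apply/negP => ux.
  have : \forall t \near x, 0 < psi t - u w t.
    have cdiff : {for x, continuous (fun t => psi t - u w t)}.
      by apply: cvgB; [exact: cpsi|exact: cu].
    by apply: (cvgr_gt _ cdiff); rewrite subr_gt0.
  have : \forall t \near x, t \in `]a, b[%R by apply: near_in_itvoo; rewrite in_itv.
  move=> near1 near2.
  have [e /= e0 He] : nbhs x [set t | t \in `]a, b[%R /\ 0 < psi t - u w t].
    by apply: filterI.
  have /rat_in_itvoo[q] : x - e < x + e by rewrite ltrBlDr -addrA ltrDl addr_gt0.
  rewrite in_itv/= => /andP[q1 q2].
  have [] := He (ratr q); first by rewrite /ball_/= ltr_distlC ltrBlDr -ltrBlDr q1 q2.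
  rewrite in_itv/= => /andP[aq qb]; rewrite subr_gt0 ltNge => /negP; apply.
  by have := Hw q I; rewrite /A (ltW aq) (ltW qb).
by apply: measurableC; apply: bigcupT_measurable_rat => q; exact: measurableC.
Qed.

End events.

(** * Choice of the constants and final estimate *)

Theorem mainTheorem1 (R : realType) (d : measure_display) (T : measurableType d)
  (P : probability T R) (delta lambda0 : R) (phi g : R -> R -> R)
  (l : int * int -> T -> R) :
  0 < delta < 2^-1 ->
  0 < lambda0 ->
  (* phi in C_c^infty(R^2), nonnegative, supported in [-delta,delta]^2 *)
  Cinf2 phi ->
  (forall x s, 0 <= phi x s) ->
  (forall x s, phi x s != 0 -> `|x| <= delta /\ `|s| <= delta) ->
  (* the l(i,j) are i.i.d. exponential random variables of parameter lambda0 *)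
  (forall k, measurable_fun setT (l k)) ->
  mutually_independent P l ->
  (forall k (r : R), 0 <= r ->
     P [set w | r < l k w] = (expR (- (lambda0 * r)))%:E) ->
  (* g nonnegative and C^1 *)
  Ck2 1 g ->
  (forall x s, 0 <= g x s) ->
  (* zero mean of f (almost surely) *)
  {ae P, forall w : T,
     (fun L : R => (2 * L) ^-2 *
        Rintegral ((@lebesgue_measure R) \x (@lebesgue_measure R))%E
          (`[- L, L] `*` `[- L, L]) (fun z => rfield g phi l z.1 z.2 w))
       @ +oo --> (0 : R)} ->
  exists F0 C K : R, 0 < F0 /\ 0 < C /\ 0 < K /\
    forall F : R, F0 < F ->
    exists N0 : nat, forall N : nat, (N0 <= N)%N ->
    forall u : T -> R -> R,
      (forall x, measurable_fun setT (fun w => u w x)) ->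
      (forall w, dirichlet_solution (fun x s => rfield g phi l x s w) F
                    (- N%:R + delta) (N%:R - delta) (u w)) ->
      (forall w x, - N%:R + delta <= x <= N%:R - delta -> 0 <= u w x) ->
      ((1 - C * expR (- (N%:R / C)))%:E <=
      P [set w | forall x, (- N%:R + delta <= x <= N%:R - delta)%R ->
                   (Num.max (K * (N%:R - 1) - K * `|x|) 0 <= u w x)%R])%E.
Proof.
move=> delta_bounds lam0 phi_smooth phi0 phi_supp l_meas l_indep l_tail g_C1 g0 _.
have phi_cont : continuous (fun z : R * R => phi z.1 z.2).
  by have [] := phi_smooth 0%N [::] isT.
have g_cont : continuous (fun z : R * R => g z.1 z.2).
  by have [] := g_C1 [::] isT.
have [B B0 phiB] := bump_bounded phi_cont phi_supp.
have /andP[d0 d1] := delta_bounds.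
(* The lower bound [lambda0 / 4] ensures [th <= 1]. With [th] as below, [2 * th * Phi] is
   [lambda0 / 2], half the rate of the strengths, as [layers] requires. *)
pose Phi := Num.max B (lambda0 / 4).
have Phi0 : 0 < Phi by rewrite /Phi lt_max B0.
have phi_le x s : phi x s <= Phi by rewrite /Phi le_max phiB.
pose th := lambda0 / (4 * Phi).
have th0 : 0 < th by rewrite divr_gt0// mulr_gt0.
have th1 : th <= 1.
  rewrite ler_pdivrMr ?mulr_gt0// mul1r mulrC -ler_pdivrMr//.
  by rewrite /Phi le_max lexx orbT.
have thPhi (x : R) : 2 * th * (Phi * x) = lambda0 / 2 * x.
  by rewrite /th; field; rewrite gt_eqF.
pose kappa := 2^-1 - delta.
have k0 : 0 < kappa by rewrite subr_gt0.
have k1 : kappa <= 1 by rewrite /kappa; lra.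
have tk0 : 0 < th * kappa by rewrite mulr_gt0.
pose C1 := 30 + 160 / (th * kappa) + 2 * path_const lambda0 kappa th.
(* Above this threshold the exponent [C1 - th * kappa * F / 16] is below [-1], so the failure
   probability is at most [e^(-N)]. *)
exists (Num.max 1 ((C1 + 1) * 16 / (th * kappa))), 1, 1.
split; first by rewrite lt_max ltr01.
do 2 split => //.
move=> F; rewrite gt_max => /andP[F1 FC].
have F0 : 0 <= F by rewrite ltW// (lt_trans _ F1).
exists 1%N => N N0 u u_meas u_sol u_ge0.
have n1 : 1 <= N%:R :> R by rewrite ler1n.
set Good := [set w | _].
have mGood : measurable Good.
  have -> : Good = [set w | forall x, - N%:R + delta <= x <= N%:R - delta ->
      Num.max (1 * (N%:R - 1) - 1 * `|x|) 0 <= u w x] by [].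
  apply: (@measurable_dominates R d T u (fun x => Num.max (1 * (N%:R - 1) - 1 * `|x|) 0)) => //.
  - move=> x; apply: (@continuous_max R R (fun x => 1 * (N%:R - 1) - 1 * `|x|) (fun=> 0)).
      apply: cvgB; first exact: cvg_cst.
      by apply: cvgM; [exact: cvg_cst|exact: norm_continuous].
    exact: cvg_cst.
  - move=> w x xab; have [_ [H _]] := u_sol w; have [du _] := H x xab.
    by apply: differentiable_continuous; apply/derivable1_diffP.
  - move=> w x xab; rewrite negb_and -!leNgt => xe.
    rewrite ge_max u_ge0// andbT; apply: le_trans (u_ge0 w x xab).
    (* At an endpoint [|x|] exceeds [N - 1], so the cone is negative there and nonnegativity of the
       solution suffices. *)
    have : N%:R - delta <= `|x|.
      case/orP: xe => xe; last by rewrite (le_trans xe) ?ler_norm.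
      by rewrite -normrN (le_trans _ (ler_norm _))// lerNr opprB addrC.
    lra.
pose E M := [set w | 1 <= total_path_sum l lambda0 kappa th F N M w].
have dom M := total_path_sum_bound lam0 l_meas l_indep l_tail F M k0 k1 th0 th1 N0.
have mE M : measurable (E M) by case: (dominated_markov (dom M)).
have PE M : (P (E M) <= (expR (- N%:R))%:E)%E.
  have [_] := dominated_markov (dom M); move=> H; apply: (le_trans H).
  rewrite lee_fin ler_expR -[leRHS]mulN1r ler_wpM2r//.
  move: FC; rewrite ltr_pdivrMr// => FC; rewrite -/C1.
  have : th * kappa * F = F * (th * kappa) by rewrite mulrC.
  by lra.
have [mU PU] := measure_liminf_le mE PE.
suff bad : ~` Good `<=` \bigcup_m \bigcap_(M in [set M | (m <= M)%N]) E M.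
  have : (P (~` Good) <= (expR (- N%:R))%:E)%E.
    by apply: le_trans PU; apply: le_measure; rewrite ?inE//; exact: measurableC.
  rewrite probability_setC// => H.
  rewrite mul1r divr1 EFinB leeBlDr// addeC -leeBlDr//.
  by rewrite fin_num_measure.
move=> w /= nGood.
have [x0 x0ab x0bad] : exists2 x, - N%:R + delta <= x <= N%:R - delta &
    u w x < Num.max (1 * (N%:R - 1) - 1 * `|x|) 0.
  apply: contrapT => nex; apply: nGood => x xab; rewrite leNgt; apply/negP => lt.
  by apply: nex; exists x.
have {}x0bad : u w x0 < N%:R - 1 - `|x0|.
  move: x0bad; rewrite lt_max !mul1r => /orP[//|]; by rewrite ltNge u_ge0.
have [h [s [V [h0 steps big]]]] := @bad_solution_path R delta F Phi phi g (fun k => l k w) N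
  (u w) x0 delta_bounds phi_cont phi0 phi_supp phi_le g_cont g0 F0 N0 (u_sol w) (u_ge0 w)
  x0ab x0bad th th0 th1.
set L := (2 * N).-1 in steps big.
pose lmax n t : R := Num.max (l (column N n,
  h n - (`|s n|%N + V n + 2)%N%:Z + t%:Z) w) 0.
(* A truncation level above the initial state, all slope variations and all strengths on this path;
   every later [M] also captures the path, as the limit inferior demands. *)
pose M0 := (`|h 0%N|%N + `|s 0%N|%N + \sum_(n < L) V n +
  \sum_(n < L) \sum_(t < 2 * `|s n|%N + 2 * V n + 5) (Num.truncn (lmax n t)).+1).+1%N.
exists M0 => // M /= M0M; rewrite /E /=.
have hM : (`|h 0%N| < M)%N by rewrite (leq_trans _ M0M)// ltnS -!addnA leq_addr.
have sM : (`|s 0%N| < M)%N.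
  by rewrite (leq_trans _ M0M)// ltnS -!addnA addnCA leq_addr.
have VM n : (n < L)%N -> (V n < M)%N.
  move=> nL; rewrite (leq_trans _ M0M)// ltnS -addnA addnCA.
  apply: (leq_trans _ (leq_addr _ _)).
  by rewrite (bigD1 (Ordinal nL))//= leq_addr.
have lM n t : (n < L)%N -> (t < 2 * `|s n|%N + 2 * V n + 5)%N -> lmax n t <= M%:R.
  move=> nL tn; apply: ltW; apply: (lt_le_trans (truncnS_gt _)).
  rewrite ler_nat (leq_trans _ M0M)// leqW//; apply: (leq_trans _ (leq_addl _ _)).
  rewrite (bigD1 (Ordinal nL))//=; apply: (leq_trans _ (leq_addr _ _)).
  by rewrite (bigD1 (Ordinal tn))//= leq_addr.
have cE n : (fun m => 2 * th * (Phi * Num.max (l (column N n, m) w) 0)) =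
    (fun m => lambda0 / 2 * Num.max (l (column N n, m) w) 0).
  by apply/funext => m; rewrite thPhi.
have path : \prod_(n < L) cell_factor (th / 2 * weight kappa N n)
      (fun m => 2 * th * (Phi * Num.max (l (column N n, m) w) 0)) (h n) (s n) (V n) <=
    path_sum l lambda0 M (fun n => th / 2 * weight kappa N n) (column N) L 0 (h 0%N) (s 0%N) w.
  apply: (le_trans _ (@path_sum_ge R d T l lambda0 lam0 M
    (fun n => th / 2 * weight kappa N n) (column N) h s V w L 0%N _ _ _)).
  - rewrite le_eqVlt; apply/orP; left; apply/eqP; apply: eq_bigr => n _.
    by rewrite add0n cE.
  - by move=> j jL; rewrite add0n VM.
  - by move=> j jL; rewrite add0n; exact: steps.
  - by move=> j t jL; rewrite add0n; exact: lM.
have PS0 := path_sum_ge0 l lambda0 M (fun n => th / 2 * weight kappa N n) (column N) L 0.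
have reorder (x y z p q : R) : x * y * z * p * q = x * y * (p * (z * q)) by ring.
apply: (le_trans big); rewrite reorder.
apply: ler_wpM2l; first exact: (mulr_ge0 (expR_ge0 _) (expR_ge0 _)).
apply: (le_trans _ (@ler_sum_term R _ (fun h0 : 'I_M => _) (Ordinal hM) _)); last first.
  move=> h0'; apply: mulr_ge0; first exact: expR_ge0.
  apply: sumr_ge0 => v _; apply: mulr_ge0; first exact: expR_ge0.
  by apply: sumr_ge0 => sg _; exact: PS0.
apply: ler_wpM2l; first exact: expR_ge0.
apply: (le_trans _ (@ler_sum_term R _ (fun v : 'I_M => _) (Ordinal sM) _)); last first.
  move=> v; apply: mulr_ge0; first exact: expR_ge0.
  by apply: sumr_ge0 => sg _; exact: PS0.
apply: ler_wpM2l; first exact: expR_ge0.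
apply: (le_trans path).
have hE : `|h 0%N|%N%:Z = h 0%N by rewrite gez0_abs.
have sE : s 0%N = if s 0%N < 0 then - `|s 0%N|%N%:Z else `|s 0%N|%N%:Z.
  by case: ltP => ?; [rewrite ltz0_abs ?opprK|rewrite gez0_abs].
rewrite {1}sE -{1}hE.
exact: (@ler_sum_term R _ (fun sg : bool => path_sum l lambda0 M
  (fun n => th / 2 * weight kappa N n) (column N) L 0 `|h 0%N|%N%:Z
  (if sg then - `|s 0%N|%N%:Z else `|s 0%N|%N%:Z) w) (s 0%N < 0) (fun sg => PS0 _ _ _)).
Qed.
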